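(* For the fixed-sample-size model described in the context, the sequence $\{(n^{-1}A_n,n^{-1}B_n,n^{-1}C_n)\}_{n\ge N}$ converges almost surely to a (possibly sample-path dependent) compact, connected, internally chain transitive invariant set, contained in $\mathcal S$, corresponding to the autonomous ODE $$(\dot a(t),\dot b(t),\dot c(t))=h(a(t),b(t),c(t))\ \text{ for } t\ge 0,\qquad (a(0),b(0),c(0))=(A_N/N,0,0).$$
   Context: **Model (fixed sample size).** Fix integers $N,k\ge 1$, a constant $\beta>0$, a memory parameter $p\in[0,1]\setminus\{1/2\}$, and a reinforcement function $f:[0,1]\to[0,1]$. Put $g(x)=pf(x)+(1-p)\{1-f(x)\}$, so $g:[0,1]\to[0,1]$. $G_N$ is the graph with vertices $v_1,\dots,v_N$ and no edges; each $v_i$ ($i\le N$) has an arbitrary state $X_i\in\{+1,-1\}$. For $n\ge N$, given the $\sigma$-field $\mathcal F_n$ of all information up to and including epoch $n$ (i.e. the directed multigraph $G_n$ on $v_1,\dots,v_n$, its states and its history), a new vertex $v_{n+1}$ arrives and indices $U_{n,1},\dots,U_{n,k}$ are drawn, conditionally i.i.d. given $\mathcal F_n$, with $$\mathbf P[U_{n,1}=m\mid\mathcal F_n]=\frac{\mathrm{indeg}_n(v_m)+\beta}{\sum_{j=1}^n \mathrm{indeg}_n(v_j)+n\beta},\quad m\in\{1,\dots,n\},$$ where $\mathrm{indeg}_n(v)$ is the in-degree of $v$ in $G_n$, counted with multiplicity. Let $P_n=\#\{i\le k: X_{U_{n,i}}=+1\}$. Given $\mathcal F_n$ and the sample, $X_{n+1}=+1$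 with probability $g(P_n/k)$ and $X_{n+1}=-1$ with probability $1-g(P_n/k)$. Then, for each $i\in\{1,\dots,k\}$ with $X_{U_{n,i}}=X_{n+1}$, a directed edge from $v_{n+1}$ to $v_{U_{n,i}}$ is added (repeated edges kept), giving $G_{n+1}$. States never change afterwards. **Statistics.** $A_n=\#\{i\le n:X_i=+1\}$, $B_n=\sum_{i\le n,\,X_i=+1}\mathrm{indeg}_n(v_i)$, $C_n=\sum_{i\le n}\mathrm{indeg}_n(v_i)$. **Drift.** $\mathcal S=\{(a,b,c)\in[0,1]\times[0,k]\times[0,k]:c\ge b\}$; $q_\beta(a,b,c)=\frac{b+\beta a}{c+\beta}\in[0,1]$ for $(a,b,c)\in\mathcal S$. With $Y\sim\mathrm{Binomial}(k,q_\beta(a,b,c))$, set $H_1(a,b,c)=\mathbf E[g(Y/k)]$, $H_2(a,b,c)=\mathbf E[Yg(Y/k)]$, $H_3(a,b,c)=\mathbf E[Yg(Y/k)+(k-Y)\{1-g(Y/k)\}]$, $H=(H_1,H_2,H_3)$, and $h(a,b,c)=H(a,b,c)-(a,b,c)$ on $\mathcal S$. **Dynamical notions.** For a (well-posed) ODE $\dot{\mathbf x}=h(\mathbf x)$, a set $A\subset\mathcal S$ is *invariant* if for every $\mathbf u\in A$ the solution $\mathbf x_{\mathbf u}$ with $\mathbf x_{\mathbf u}(0)=\mathbf u$ is defined for all $t\in\mathbb R$ and stays in $A$ for all $t\in\mathbb R$. A set $A$ is *internally chain transitive* if it is invariant, compact, and for all $\mathbf u,\mathbf v\in A$, $\epsilon>0$,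 $T>0$ there are $m\ge1$, points $\mathbf u_0=\mathbf u,\mathbf u_1,\dots,\mathbf u_m=\mathbf v$ in $A$ and times $t_1,\dots,t_m\ge T$ with $\|\mathbf x_{\mathbf u_{i-1}}(t_i)-\mathbf u_i\|<\epsilon$ for all $i\in\{1,\dots,m\}$. A sequence $z_n$ converges to a set $L$ if $\inf_{\mathbf w\in L}\|z_n-\mathbf w\|\to0$. *)

(* Defs.v *)
From HB Require Import structures.
From mathcomp Require Import all_boot all_order all_algebra.
From mathcomp Require Import all_classical all_reals all_analysis.

Set Implicit Arguments.
Unset Strict Implicit.
Unset Printing Implicit Defensive.

Import Order.TTheory GRing.Theory Num.Theory.
Import numFieldNormedType.Exports.

Local Open Scope classical_set_scope.
Local Open Scope ring_scope.

Section Model.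
Context (R : realType) (d : measure_display) (T : measurableType d).
Context (P : probability T R).

(* phi is a version of the conditional probability of E given the sub-sigma-
   field G. *)
Definition is_cond_prob (G : set (set T)) (E : set T) (phi : T -> R) : Prop :=
  (forall B : set R, measurable B -> G (phi @^-1` B)) /\
  (forall A, G A -> P (A `&` E) = (\int[P]_(w in A) (phi w)%:E)%E).

(* Vertices are numbered from 0: vertex i is the v_{i+1} of the usual
   1-based numbering, G_n has vertices 0, ..., n-1, and the vertex arriving at
   epoch n is vertex n.  The state +1 is encoded by true, -1 by false.
   U n j is the j-th index sampled at epoch n; it is meaningful for n >= N. *)
Context (N k : nat) (X : nat -> T -> bool) (U : nat -> 'I_k -> T -> nat).

(* number of edges from vertex m to vertex i, for m >= N *)
Definition edge_mult (m i : nat) (w : T) : nat :=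
  #|[set j : 'I_k | (U m j w == i) && (X i w == X m w)]|.

Definition indeg (n i : nat) (w : T) : nat :=
  \sum_(N <= m < n) edge_mult m i w.

(* sigma-field of the states of the vertices below a and of the samples drawn
   at the epochs N, ..., b-1 *)
Definition history (a b : nat) : set (set T) :=
  <<s [set E : set T |
    (exists2 i, (i < a)%N & preimage_set_system setT (X i) measurable E) \/
    (exists m (j : 'I_k), (N <= m < b)%N /\
       preimage_set_system setT (U m j) measurable E)] >>.

Definition sampling_weight (beta : R) (n i : nat) (w : T) : R :=
  ((indeg n i w)%:R + beta) /
  (\sum_(l < n) (indeg n l w)%:R + n%:R * beta).

(* the number P_n of sampled vertices in state +1 *)
Definition plus_count (n : nat) (w : T) : nat :=
  #|[set j : 'I_k | X (U n j w) w]|.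

Record fixed_sample_model (beta : R) (g : R -> R) : Prop := FixedSampleModel {
  states_measurable : forall i, measurable_fun setT (X i) ;
  samples_measurable : forall n j, (N <= n)%N -> measurable_fun setT (U n j) ;
  samples_range : forall n j w, (N <= n)%N -> (U n j w < n)%N ;
  (* the product form of the joint law expresses that the k indices are
     conditionally i.i.d. *)
  samples_law : forall n (u : 'I_k -> 'I_n), (N <= n)%N ->
    is_cond_prob (history n n) [set w | forall j, U n j w = u j]
      (fun w => \prod_(j < k) sampling_weight beta n (u j) w) ;
  state_law : forall n, (N <= n)%N ->
    is_cond_prob (history n n.+1) [set w | X n w]
      (fun w => g ((plus_count n w)%:R / k%:R)) }.

Definition countA (n : nat) (w : T) : nat := \sum_(i < n | X i w) 1.
Definition countB (n : nat) (w : T) : nat := \sum_(i < n | X i w) indeg n i w.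
Definition countC (n : nat) (w : T) : nat := \sum_(i < n) indeg n i w.

Definition statistics (w : T) (n : nat) : R * R * R :=
  ((countA n w)%:R / n%:R, (countB n w)%:R / n%:R, (countC n w)%:R / n%:R).

End Model.

Section Drift.
Context (R : realType).

Definition response (p : R) (f : R -> R) (x : R) : R :=
  p * f x + (1 - p) * (1 - f x).

Context (k : nat) (beta : R) (g : R -> R).

Definition state_space : set (R * R * R) :=
  [set x | let: (a, b, c) := x in
    [/\ 0 <= a <= 1, 0 <= b <= k%:R, 0 <= c <= k%:R & b <= c]].

Definition qbeta (x : R * R * R) : R :=
  let: (a, b, c) := x in (b + beta * a) / (c + beta).

(* E[F Y] for Y ~ Binomial(k, q) *)
Definition binomial_mean (q : R) (F : nat -> R) : R :=
  fine ('E_(binomial_prob k q)[F])%E.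

Definition H1 (x : R * R * R) : R :=
  binomial_mean (qbeta x) (fun y => g (y%:R / k%:R)).
Definition H2 (x : R * R * R) : R :=
  binomial_mean (qbeta x) (fun y => y%:R * g (y%:R / k%:R)).
Definition H3 (x : R * R * R) : R :=
  binomial_mean (qbeta x)
    (fun y => y%:R * g (y%:R / k%:R) + (k%:R - y%:R) * (1 - g (y%:R / k%:R))).

Definition drift (x : R * R * R) : R * R * R := (H1 x, H2 x, H3 x) - x.

End Drift.

Section Dynamics.
Context (R : realType) (V : normedModType R).
(* the vector field h is only considered on its domain D *)
Context (D : set V) (h : V -> V).

(* x solves the ODE on J.  The values of x outside J are irrelevant: at an
   endpoint of J, the two-sided derivative is no more than the one-sided one,
   since x can be continued affinely outside J. *)
Definition ode_solution (J : set R) (u : V) (x : R -> V) : Prop :=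
  x 0 = u /\ forall t, J t -> D (x t) /\ is_derive t 1 x (h (x t)).

(* x is "the" solution started at u: it solves the ODE and is the only one. *)
Definition the_solution (J : set R) (u : V) (x : R -> V) : Prop :=
  ode_solution J u x /\
  (forall y, ode_solution J u y -> forall t, J t -> y t = x t).

Definition ode_invariant (A : set V) : Prop :=
  A `<=` D /\
  forall u, A u -> exists2 x, the_solution setT u x & forall t, A (x t).

Definition internally_chain_transitive (A : set V) : Prop :=
  [/\ ode_invariant A, compact A &
    forall (u v : V) (eps tmin : R), A u -> A v -> 0 < eps -> 0 < tmin ->
    exists (m : nat) (c : nat -> V) (tau : nat -> R),
    [/\ (0 < m)%N, c 0%N = u, c m = v,
        forall i, (i <= m)%N -> A (c i) &
        forall i, (0 < i <= m)%N -> tmin <= tau i /\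
          exists2 x, the_solution setT (c i.-1) x &
                     `|x (tau i) - c i| < eps]].

(* L has to be nonempty: the library sets inf set0 = 0, not +oo. *)
Definition converges_to_set (z : nat -> V) (L : set V) : Prop :=
  L !=set0 /\ inf [set `|z n - y| | y in L] @[n --> \oo] --> (0 : R).

End Dynamics.

(* Main.v *)
Require Import Defs.
From mathcomp Require Import all_boot all_order all_algebra.
From mathcomp Require Import all_classical all_reals all_analysis.
From mathcomp Require Import measurable_realfun ring lra zify.

Set Implicit Arguments.
Unset Strict Implicit.
Unset Printing Implicit Defensive.

Import Order.TTheory GRing.Theory Num.Theory.
Import numFieldNormedType.Exports.

Local Open Scope classical_set_scope.
Local Open Scope ring_scope.

(** The statistics form a stochastic approximation.  Write [z n] for the triple
[(A_n, B_n, C_n) / n].  A vertex in state +1 is drawn at epoch [n] with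
probability exactly [qbeta (z n)], so the number of sampled +1 vertices is
binomial given the past, the increment of [(A, B, C)] has conditional mean
[h (z n) + z n], and its deviation from that mean is a bounded martingale
difference.  Let [eta n] be the sum of the first [n] deviations divided by [n].
Then [z n - eta n] is an Euler scheme for the field [h] evaluated at [z n],
with step [1 / (n + 1)] and perturbation [eta n] ([statistics_recursion]).

Probability enters only through [eta n -> 0] almost surely
([innovation_slln]).  This is a strong law for pairwise orthogonal variables
bounded by a constant [K] ([orthogonal_slln]): the second moment of the sum of
[n] of them is at most [K^2 n], so the averages along the squares are square summable and
vanish, and the averages between two consecutive squares differ little.
Orthogonality to the past is a finite computation ([integral_mul_past]),
because the past takes finitely many values and the transition probabilities
out of each value are given by the model ([transition_law]); the sum over the
samples collapses to a binomial mean ([sum_samples]).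

Everything else is deterministic.  For the iterates of a scheme,
[p b - p a = (s b - s a) h (p a)] up to an error quadratic in the elapsed time
plus a multiple of the perturbation ([scheme_step]).  This estimate survives a
pointwise limit, which exists along a free ultrafilter on the integers by
compactness of the state space, and turns into the differential equation
([scheme_ultralimit]).  Used with Euler polygons of vanishing step it gives
forward solutions from every point of the state space; used with the sequence
[z] itself, seen from times at which it is close to a point of its limit set,
it gives a solution on the whole line through this point which stays in the
limit set.  Solutions are unique because [h] is Lipschitz there, [h + id] being
a polynomial in [qbeta].

The limit set of [z] is therefore compact and invariant.  It is connected since
the increments of [z] vanish.  It is internally chain transitive since by a
discrete Gronwall estimate ([scheme_tracking]) solutions starting close to a
late [z n] shadow [z] for a bounded time: a stretch of [z] leading from near
[u] to near [v] is cut into pieces of moderate duration, and the cut points are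
replaced by points of the limit set close to them. *)

(** * Perturbed Euler schemes *)

Section QuadraticBound.
Context (R : realType) (V : normedModType R).

Lemma ler_add_vanishing (x y K : R) :
  (forall e, 0 < e -> x <= y + e * K) -> x <= y.
Proof.
move=> H; apply/ler_addgt0Pr => e e0.
have K0 : 0 < `|K| + 1 by rewrite ltr_wpDl.
have := H (e / (`|K| + 1)) (divr_gt0 e0 K0).
move=> /le_trans; apply; rewrite lerD2l.
apply: (@le_trans _ _ (e / (`|K| + 1) * (`|K| + 1))); last by rewrite divfK// gt_eqF.
by rewrite ler_pM2l ?divr_gt0// (le_trans (ler_norm _))// lerDl.
Qed.

(** A first-order expansion with quadratic error determines the derivative.  All
solutions below are built as limits, and bounds of this kind, unlike
derivatives, pass to pointwise limits. *)
Lemma is_derive_quadratic (x : R -> V) (t C : R) (v : V) :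
  (\forall s \near t, `|x s - x t - (s - t) *: v| <= C * (s - t) ^+ 2) ->
  is_derive t 1 x v.
Proof.
move=> H.
have C0 : 0 < `|C| + 1 by rewrite ltr_wpDl.
suff cv : (fun h => h^-1 *: ((x \o shift t) (h *: 1) - x t)) @ 0^' --> v.
  by apply: DeriveDef; [exact: cvgP cv | exact: cvg_lim cv].
apply/cvgrPdist_le => e e0.
have H0 : \forall h \near (0:R), `|x (h + t) - x t - h *: v| <= C * h ^+ 2.
  move/nbhs_ballP : H => [r r0 H]; apply/nbhs_ballP; exists r => //= h.
  rewrite -ball_normE /= sub0r normrN => hr.
  have /H : ball t r (h + t) by rewrite -ball_normE /= distrC addrK.
  by rewrite /= addrK.
near=> h.
have hN0 : h != 0 by near: h; exact: nbhs_dnbhs_neq.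
rewrite /= -normrN opprB scaler1.
have -> : h^-1 *: (x (h + t) - x t) - v = h^-1 *: (x (h + t) - x t - h *: v).
  by rewrite [in RHS]scalerBr scalerA mulVf// scale1r.
rewrite normrZ normfV mulrC ler_pdivrMr ?normr_gt0//.
apply: le_trans (_ : (`|C| + 1) * `|h| * `|h| <= _).
  apply: le_trans (_ : C * h ^+ 2 <= _); last first.
    rewrite -mulrA -expr2 real_normK ?num_real// ler_wpM2r ?sqr_ge0//.
    by rewrite (le_trans (ler_norm _))// lerDl.
  near: h; apply: cvg_within; exact: H0.
rewrite ler_wpM2r// mulrC -ler_pdivlMr//.
near: h; apply: cvg_within.
near=> h; apply/ltW; rewrite -[h]subr0 distrC; near: h.
exact: (nbhsx_ballx (0:R) _ (divr_gt0 e0 C0)).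
Unshelve. all: by end_near. Qed.


Lemma shifted_diff (W : zmodType) (p q e f : W) :
  p - q = (p - e) - (q - f) + (e - f).
Proof. by rewrite opprB addrACA subrK [f - q - f]addrAC subrr sub0r. Qed.

Lemma scaled_step (W : lmodType R) (g a : R) (x w u v e : W) :
  x + g *: (u + e) - w - (g + a) *: v =
  (x - w - a *: v) + g *: (u - v + e).
Proof.
rewrite [u - v + e]addrAC scalerBr scalerDl opprD [- _ - _]addrC.
by rewrite (addrAC x) -!addrA; congr (_ + (_ + _)); rewrite addrCA.
Qed.

Section Scheme.
Variables (D : set V) (h : V -> V) (L M : R).
Hypothesis L0 : 0 <= L.
Hypothesis hlip : forall u v, D u -> D v -> `|h u - h v| <= L * `|u - v|.
Hypothesis hbd : forall u, D u -> `|h u| <= M.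

(** The perturbation enters twice: [p i - e i] is the sequence that makes the steps,
and [e i] is added to the field.  A stochastic approximation takes this form when
[e] is the running average of its noise. *)
Definition scheme_from (s : nat -> R) (p e : nat -> V) (eta : R) (a : nat) :=
  forall i, (a <= i)%N -> [/\ D (p i), `|e i| <= eta, s i <= s i.+1 &
    p i.+1 - e i.+1 = p i - e i + (s i.+1 - s i) *: (h (p i) + e i)].

Lemma scheme_le s p e eta a b : scheme_from s p e eta a -> (a <= b)%N ->
  s a <= s b.
Proof.
move=> H /subnKC <-; elim: (b - a)%N => [|n IH]; first by rewrite addn0.
have [] := H (a + n)%N (leq_addr _ _) => _ _ + _.
by rewrite -addnS; exact: le_trans.
Qed.

Lemma scheme_increment s p e eta a b : scheme_from s p e eta a -> (a <= b)%N ->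
  `|p b - p a| <= (M + eta) * (s b - s a) + 2 * eta.
Proof.
move=> H ab.
have N1 : `|(p b - e b) - (p a - e a)| <= (M + eta) * (s b - s a).
  move: ab => /subnKC <-; elim: (b - a)%N => [|n IH].
    by rewrite addn0 !subrr normr0 mulr0.
  rewrite addnS; have [Dp ep sp ->] := H (a + n)%N (leq_addr _ _).
  rewrite addrAC (le_trans (ler_normD _ _))//.
  rewrite (le_trans (lerD IH (lexx _)))// normrZ ger0_norm ?subr_ge0//.
  have : `|h (p (a + n)%N) + e (a + n)%N| <= M + eta.
    by rewrite (le_trans (ler_normD _ _))// lerD// hbd.
  move=> /(ler_wpM2l (_ : 0 <= s (a + n).+1 - s (a + n)%N)).
  rewrite subr_ge0 => /(_ sp); lra.
have [_ ea _ _] := H a (leqnn a); have [_ eb _ _] := H b ab.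
have -> : p b - p a = (p b - e b) - (p a - e a) + (e b - e a).
  exact: shifted_diff.
rewrite (le_trans (ler_normD _ _))// lerD//.
by rewrite (le_trans (ler_normB _ _))//; lra.
Qed.

(** The field moves by at most [L] times the displacement, itself controlled by
[scheme_increment], so freezing it at [p a] costs an error quadratic in the
elapsed time; the perturbation contributes terms proportional to [eta]. *)
Lemma scheme_step s p e eta a b : scheme_from s p e eta a -> (a <= b)%N ->
  `|p b - p a - (s b - s a) *: h (p a)| <=
  L * (M + eta) * (s b - s a) ^+ 2 + eta * (2 + (2 * L + 1) * (s b - s a)).
Proof.
move=> H ab.
have [Da ea _ _] := H a (leqnn a); have [_ eb _ _] := H b ab.
have N1 : `|(p b - e b) - (p a - e a) - (s b - s a) *: h (p a)| <=
  L * (M + eta) * (s b - s a) ^+ 2 + eta * ((2 * L + 1) * (s b - s a)).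
  move: {eb} ab => /subnKC <-; elim: (b - a)%N => [|n IH].
    by rewrite addn0 !subrr scale0r subr0 normr0 !expr0n/= !mulr0 addr0.
  rewrite addnS; have [Dp ep sp ->] := H (a + n)%N (leq_addr _ _).
  set c := (a + n)%N in Dp ep sp IH *.
  have sac : s a <= s c by apply: (scheme_le H); exact: leq_addr.
  have -> : p c - e c + (s c.+1 - s c) *: (h (p c) + e c) - (p a - e a) -
    (s c.+1 - s a) *: h (p a) =
    (p c - e c - (p a - e a) - (s c - s a) *: h (p a)) +
    (s c.+1 - s c) *: (h (p c) - h (p a) + e c).
    have -> : s c.+1 - s a = (s c.+1 - s c) + (s c - s a) by rewrite addrA subrK.
    exact: scaled_step.
  rewrite (le_trans (ler_normD _ _))//.
  rewrite (le_trans (lerD IH (lexx _)))// normrZ ger0_norm ?subr_ge0//.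
  have N2 : `|h (p c) - h (p a) + e c| <= L * ((M + eta) * (s c - s a) + 2 * eta) + eta.
    rewrite (le_trans (ler_normD _ _))// lerD// (le_trans (hlip _ _))//.
    by rewrite ler_wpM2l// (scheme_increment H)// leq_addr.
  have M0 : 0 <= M + eta.
    by rewrite addr_ge0// ?(le_trans (normr_ge0 _) ea)// (le_trans (normr_ge0 _) (hbd Da)).
  have g0 : 0 <= s c.+1 - s c by rewrite subr_ge0.
  apply: (le_trans (lerD (lexx _) (ler_wpM2l g0 N2))).
  have d0 : 0 <= s c - s a by rewrite subr_ge0.
  have LM0 : 0 <= L * (M + eta) by rewrite mulr_ge0.
  have -> : s c.+1 - s a = (s c.+1 - s c) + (s c - s a) by rewrite addrA subrK.
  have h1 := mulr_ge0 LM0 (mulr_ge0 g0 d0).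
  have h2 := mulr_ge0 LM0 (mulr_ge0 g0 g0).
  rewrite -subr_ge0.
  set g := s c.+1 - s c in h1 h2 *; set dd := s c - s a in h1 h2 *.
  apply: le_trans (addr_ge0 h1 h2) _; rewrite le_eqVlt; apply/orP; left; apply/eqP.
  by rewrite !expr2; ring.
have -> : p b - p a - (s b - s a) *: h (p a) =
  ((p b - e b) - (p a - e a) - (s b - s a) *: h (p a)) + (e b - e a).
  by rewrite [RHS]addrAC; congr (_ - _); exact: shifted_diff.
rewrite (le_trans (ler_normD _ _))// (le_trans (lerD N1 (ler_normB _ _)))//.
rewrite (_ : _ + eta * (2 + _) = L * (M + eta) * (s b - s a) ^+ 2 +
  eta * ((2 * L + 1) * (s b - s a)) + 2 * eta); last by ring.
by rewrite lerD//; lra.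
Qed.

End Scheme.
End QuadraticBound.

(** * Limits of schemes along ultrafilters *)

Section GridLimit.
Context (R : realType) (V : normedModType R).
Variables (D : set V) (h : V -> V) (L M : R).
Hypothesis cD : compact D.
Hypothesis L0 : 0 <= L.
Hypothesis hlip : forall u v, D u -> D v -> `|h u - h v| <= L * `|u - v|.
Hypothesis hbd : forall u, D u -> `|h u| <= M.

(** By compactness alone, limits along an ultrafilter exist for all times
simultaneously. *)
Lemma ultra_cvg (F : set_system nat) (FU : UltraFilter F) (u : nat -> V) :
  (\forall n \near F, D (u n)) -> exists2 l, D l & u @ F --> l.
Proof.
move=> FD; have [l [Dl cl]] := cD (fmap_proper_filter u _) FD.
exists l => // B nB; rewrite /= nbhs_filterE.
have [//|FnB] := in_ultra_setVsetC (u @^-1` B) FU.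
by have [y [/= nBy By]] := cl (~` B) B FnB nB; case: (nBy By).
Qed.

Lemma lipschitz_cvg (F : set_system nat) (FF : Filter F) (u : nat -> V) l :
  (\forall n \near F, D (u n)) -> D l -> u @ F --> l -> (h \o u) @ F --> h l.
Proof.
move=> FD Dl ul; apply/cvgrPdist_le => e e0.
have L1 : 0 < L + 1 by rewrite ltr_wpDl.
move/cvgrPdist_le : ul => /(_ _ (divr_gt0 e0 L1)).
apply: filterS2 FD => n Dn ln; rewrite (le_trans (hlip _ _))//.
rewrite (le_trans (ler_wpM2l L0 ln))// mulrCA ger_pMr//.
by rewrite ler_pdivrMr// mul1r lerDl.
Qed.

Variables (F : set_system nat) (FU : UltraFilter F) (J : set R).
Variables (p e : nat -> nat -> V) (s : nat -> nat -> R) (c : nat -> R).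
Variable (a : nat -> R -> nat).
Hypothesis Hscheme : forall t eta, J t -> 0 < eta ->
  \forall n \near F, scheme_from D h (s n) (p n) (e n) eta (a n t).
Hypothesis Hmono : forall n, {homo a n : t t' / t <= t' >-> (t <= t')%N}.
Hypothesis Htime : forall t, J t -> s n (a n t) - c n @[n --> F] --> t.

(** The estimates of [scheme_increment] and [scheme_step] hold for every [eta]
eventually along [F]; in the limit the perturbation disappears from them and
only the quadratic error is left.  Backward increments are reduced to forward
ones at the price of replacing [h (x t')] by [h (x t)], whence the factor 2.
The offset [c n] makes room for schemes read from a starting time that goes to
infinity with [n]. *)
Lemma scheme_ultralimit : exists x : R -> V,
  (forall t, J t -> D (x t) /\ p n (a n t) @[n --> F] --> x t) /\
  (forall t t', J t -> J t' ->
    `|x t' - x t - (t' - t) *: h (x t)| <= 2 * L * M * (t' - t) ^+ 2).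
Proof.
have nD t : J t -> \forall n \near F, D (p n (a n t)).
  move=> Jt; apply: filterS (Hscheme Jt ltr01) => n H.
  by have [] := H _ (leqnn _).
have ex t : exists y, J t -> D y /\ p n (a n t) @[n --> F] --> y.
  have [Jt|nJ] := pselect (J t); last by exists 0.
  by have [y Dy cy] := ultra_cvg FU (nD t Jt); exists y.
have [x Hx] := choice ex.
exists x; split => //.
have Hds t t' : J t -> J t' ->
    s n (a n t') - s n (a n t) @[n --> F] --> t' - t.
  move=> Jt Jt'.
  rewrite [X in X @ _ --> _](_ : _ = (fun n => s n (a n t') - c n) -
    (fun n => s n (a n t) - c n)); last first.
    by apply/funext => n /=; rewrite /= !fctE opprB addrA subrK.
  exact: cvgB (Htime Jt') (Htime Jt).
have Hinc t t' : J t -> J t' -> t <= t' ->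
    `|x t' - x t| <= M * (t' - t).
  move=> Jt Jt' tt'.
  apply: (@ler_add_vanishing _ _ _ (t' - t + 2)) => eta eta0.
  have -> : M * (t' - t) + eta * (t' - t + 2) = (M + eta) * (t' - t) + 2 * eta.
    by ring.
  have H1 : `|p n (a n t') - p n (a n t)| @[n --> F] --> `|x t' - x t|.
    by apply: cvg_norm; apply: cvgB; [exact: (Hx _ Jt').2|exact: (Hx _ Jt).2].
  have H2 : (M + eta) * (s n (a n t') - s n (a n t)) + 2 * eta @[n --> F] -->
     (M + eta) * (t' - t) + 2 * eta.
    by apply: cvgD; [apply: cvgM; [exact: cvg_cst|exact: Hds]|exact: cvg_cst].
  apply: (ler_cvg_to H1 H2).
  apply: filterS (Hscheme Jt eta0) => n Hn.
  by apply: scheme_increment Hn _ => //; exact: Hmono.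
have Hle t t' : J t -> J t' -> t <= t' ->
    `|x t' - x t - (t' - t) *: h (x t)| <= L * M * (t' - t) ^+ 2.
  move=> Jt Jt' tt'.
  apply: (@ler_add_vanishing _ _ _ (L * (t' - t) ^+ 2 + 2 + (2 * L + 1) * (t' - t)))
    => eta eta0.
  have -> : L * M * (t' - t) ^+ 2 +
     eta * (L * (t' - t) ^+ 2 + 2 + (2 * L + 1) * (t' - t)) =
     L * (M + eta) * (t' - t) ^+ 2 + eta * (2 + (2 * L + 1) * (t' - t)) by ring.
  have H1 : `|p n (a n t') - p n (a n t) -
     (s n (a n t') - s n (a n t)) *: h (p n (a n t))| @[n --> F] -->
     `|x t' - x t - (t' - t) *: h (x t)|.
    apply: cvg_norm; apply: cvgB; first
      by apply: cvgB; [exact: (Hx _ Jt').2|exact: (Hx _ Jt).2].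
    apply: cvgZ; first exact: Hds.
    by apply: lipschitz_cvg; [exact: nD|exact: (Hx _ Jt).1|exact: (Hx _ Jt).2].
  have H2 : L * (M + eta) * (s n (a n t') - s n (a n t)) ^+ 2 +
      eta * (2 + (2 * L + 1) * (s n (a n t') - s n (a n t))) @[n --> F] -->
     L * (M + eta) * (t' - t) ^+ 2 + eta * (2 + (2 * L + 1) * (t' - t)).
    have Hd := Hds _ _ Jt Jt'.
    apply: cvgD.
      apply: cvgM; first exact: cvg_cst.
      under eq_fun do rewrite expr2.
      by rewrite expr2; exact: cvgM.
    apply: cvgM; first exact: cvg_cst.
    apply: cvgD; first exact: cvg_cst.
    by apply: cvgM; first exact: cvg_cst.
  apply: (ler_cvg_to H1 H2).
  apply: filterS (Hscheme Jt eta0) => n Hn.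
  by apply: scheme_step Hn _ => //; exact: Hmono.
move=> t t' Jt Jt'.
have M0 : 0 <= M by exact: le_trans (normr_ge0 _) (hbd (Hx _ Jt).1).
have LM0 : 0 <= L * M by rewrite mulr_ge0.
have sq0 : 0 <= (t' - t) ^+ 2 by rewrite sqr_ge0.
have [tt'|/ltW t't] := leP t t'.
  rewrite (le_trans (Hle _ _ Jt Jt' tt'))// -mulrA.
  have := mulr_ge0 LM0 sq0; lra.
have -> : x t' - x t - (t' - t) *: h (x t) =
   - (x t - x t' - (t - t') *: h (x t')) + (t - t') *: (h (x t) - h (x t')).
  rewrite -[t - t']opprB !scaleNr opprK opprD opprB scalerBr opprB.
  by rewrite addrA subrK.
rewrite (le_trans (ler_normD _ _))// normrN.
rewrite (le_trans (lerD (Hle _ _ Jt' Jt t't) (lexx _)))// normrZ ger0_norm ?subr_ge0//.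
have : `|h (x t) - h (x t')| <= L * (M * (t - t')).
  rewrite (le_trans (hlip (Hx _ Jt).1 (Hx _ Jt').1))// ler_wpM2l//.
  exact: Hinc.
move=> /(ler_wpM2l (_ : 0 <= t - t')); rewrite subr_ge0 => /(_ t't) H.
apply: le_trans (lerD (lexx _) H) _.
rewrite le_eqVlt; apply/orP; left; apply/eqP; rewrite !expr2; ring.
Qed.

End GridLimit.

Lemma free_ultrafilter_nat : exists2 F : set_system nat, UltraFilter F & F --> \oo.
Proof.
have [F [FU sF]] := ultraFilterLemma (eventually_filter).
by exists F.
Qed.

(** * Forward solutions *)

Section Euler.
Context (R : realType) (V : normedModType R).
Variables (D : set V) (h : V -> V) (L M : R).
Hypothesis cD : compact D.
Hypothesis L0 : 0 <= L.
Hypothesis hlip : forall u v, D u -> D v -> `|h u - h v| <= L * `|u - v|.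
Hypothesis hbd : forall u, D u -> `|h u| <= M.

(** Euler polygons of step [1 / (n + 1)] stay in [D] and converge along a free
ultrafilter.  The limit is extended to negative times by its tangent at 0, which
makes the two-sided derivative at 0 the required one. *)
Lemma euler_forward_solution u :
  (forall v d, D v -> 0 <= d <= 1 -> D (v + d *: h v)) -> D u ->
  exists x, ode_solution D h [set t | 0 <= t] u x.
Proof.
move=> Dstep Du; have [F FU Foo] := free_ultrafilter_nat.
pose p n i := iter i (fun v => v + n.+1%:R^-1 *: h v) u.
have Dp n i : D (p n i).
  elim: i => [//|i IH]; apply: Dstep => //.
  by rewrite invr_ge0 ler0n /= invf_le1// ler1n.
pose s n i : R := i%:R / n.+1%:R.
pose a n (t : R) := Num.truncn (t * n.+1%:R).
have [|n t t' tt'|t /= t0|x [x1 x2]] :=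
  @scheme_ultralimit R V D h L M cD L0 hlip hbd F FU [set t | 0 <= t] p
    (fun _ _ => 0) s (fun=> 0) a.
- move=> t eta t0 eta0; near=> n => i _; split => //.
  + by rewrite normr0 ltW.
  + by rewrite /s ler_pM2r ?invr_gt0// ler_nat.
  + have -> : s n i.+1 - s n i = n.+1%:R^-1.
      by rewrite /s -mulrBl -[i.+1]addn1 natrD addrAC subrr add0r mul1r.
    by rewrite !subr0 addr0.
- by apply: le_truncn; rewrite ler_pM2r.
- apply/cvgrPdist_le => e e0.
  have := @near_infty_natSinv_lt R (PosNum e0).
  move=> /Foo; apply: filterS => n /= /ltW Hn; apply: le_trans Hn.
  rewrite subr0 /s /a.
  have n0 : (0 : R) < n.+1%:R by rewrite ltr0n.
  have t0' : 0 <= t * n.+1%:R by rewrite mulr_ge0.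
  have /andP[h1 h2] := truncn_itv t0'.
  rewrite ger0_norm; last by rewrite subr_ge0 ler_pdivrMr.
  rewrite -(ler_pM2r n0) mulrBl divfK ?gt_eqF// mulVf ?gt_eqF//.
  by rewrite lerBlDr addrC natr1 ltW.
have x0 : x 0 = u.
  have /x1[_ cx] : [set t : R | 0 <= t] 0 by rewrite /=.
  have cu : p n (a n 0) @[n --> F] --> u.
    have -> : (fun n => p n (a n 0)) = fun=> u.
      by apply/funext => n; rewrite /a mul0r truncn0.
    exact: cvg_cst.
  exact: (cvg_unique (@norm_hausdorff _ V) cx cu).
exists (fun t => if t < 0 then u + t *: h u else x t); split.
  by rewrite ltxx x0.
move=> t /= t0; rewrite ltNge t0 /=; split; first exact: (x1 _ t0).1.
apply: (@is_derive_quadratic _ _ _ _ (2 * L * M)).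
have LM0 : 0 <= 2 * L * M.
  by rewrite mulr_ge0 ?mulr_ge0// (le_trans (normr_ge0 _) (hbd Du)).
rewrite [t < 0]ltNge t0 /=.
move: t0; rewrite le_eqVlt => /predU1P[<-|t0].
  near=> w; rewrite subr0 x0; case: ltP => w0.
    by rewrite [u + _]addrC addrK subrr normr0 mulr_ge0// sqr_ge0.
  by have := x2 0 w (lexx _) w0; rewrite subr0 x0.
near=> w.
have w0 : 0 < w by near: w; exact: lt_nbhsr.
by rewrite ltNge (ltW w0) /=; apply: x2; exact: ltW.
Unshelve. all: by end_near. Qed.

End Euler.

(** * The time scale of the harmonic steps *)

Section Clock.
Context (R : realType).

(** The time at which the scheme of step [1 / (n + 1)] reaches its [n]-th point. *)
Definition clock : nat -> R := series harmonic.

Lemma clockS n : clock n.+1 = clock n + n.+1%:R^-1.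
Proof. by rewrite /clock /series /= big_nat_recr. Qed.

Lemma clock_lt : {homo clock : m n / (m < n)%N >-> m < n}.
Proof.
apply: homo_ltn; first exact: lt_trans.
by move=> n; rewrite clockS ltrDl invr_gt0 ltr0n.
Qed.

Lemma clock_le : {homo clock : m n / (m <= n)%N >-> m <= n}.
Proof.
move=> m n; rewrite leq_eqVlt => /predU1P[->//|/clock_lt]; exact: ltW.
Qed.

Lemma clock_unbounded r : exists n, r <= clock n.
Proof.
apply: contrapT => H; apply: (@dvg_harmonic R).
apply: nondecreasing_is_cvgn; first exact: clock_le.
exists r => _ [n _ <-]; apply/ltW; rewrite ltNge; apply/negP => rn.
by apply: H; exists n.
Qed.

Definition index_at r := ex_minn (clock_unbounded r).

Lemma index_atP r : r <= clock (index_at r).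
Proof. by rewrite /index_at; case: ex_minnP. Qed.

Lemma index_at_le r n : r <= clock n -> (index_at r <= n)%N.
Proof. by rewrite /index_at; case: ex_minnP => m _ + rn; apply. Qed.

Lemma index_at_homo : {homo index_at : r s / r <= s >-> (r <= s)%N}.
Proof. by move=> r s rs; apply/index_at_le/(le_trans rs)/index_atP. Qed.

Lemma index_at_clock n : index_at (clock n) = n.
Proof.
apply/eqP; rewrite eqn_leq index_at_le//= leqNgt; apply/negP.
by move=> /clock_lt; rewrite ltNge index_atP.
Qed.

Lemma lt_index_at r n : clock n < r -> (n < index_at r)%N.
Proof.
move=> nr; rewrite ltnNge; apply/negP => /clock_le.
by rewrite leNgt (lt_le_trans nr (index_atP r)).
Qed.

Lemma index_at_overshoot r n : clock n < r ->
  clock (index_at r) <= r + n.+1%:R^-1.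
Proof.
move=> nr; have := lt_index_at nr.
case E : (index_at r) => [//|m]; rewrite ltnS => nm.
have : clock m < r.
  by rewrite ltNge; apply/negP => /index_at_le; rewrite E ltnn.
rewrite clockS => mr; rewrite lerD ?(ltW mr)//.
by rewrite lef_pV2 ?posrE ?ltr0n// ler_nat.
Qed.

Lemma clock_shift_infty (phi : nat -> nat) (t : R) n :
  (forall j, (j <= phi j)%N) -> \forall j \near \oo, clock n < clock (phi j) + t.
Proof.
move=> jphi; have [m Hm] := clock_unbounded (clock n + 1 - t).
near=> j.
have : clock m <= clock (phi j).
  apply/clock_le/(leq_trans _ (jphi j)).
  by near: j; exists m.
lra.
Unshelve. all: by end_near. Qed.

End Clock.

(** * The limit set of a scheme with harmonic steps *)

Section LimitSet.
Context (R : realType) (V : normedModType R).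
Variables (D : set V) (h : V -> V) (L M : R).
Hypothesis cD : compact D.
Hypothesis L0 : 0 <= L.
Hypothesis hlip : forall u v, D u -> D v -> `|h u - h v| <= L * `|u - v|.
Hypothesis hbd : forall u, D u -> `|h u| <= M.
Hypothesis huniq : forall u x y, ode_solution D h setT u x ->
  ode_solution D h setT u y -> forall t, y t = x t.

Variables (z eta : nat -> V) (N : nat).
Hypothesis zD : forall n, (N <= n)%N -> D (z n).
Hypothesis eta0 : eta @ \oo --> (0 : V).
Hypothesis zS : forall n, (N <= n)%N ->
  z n.+1 - eta n.+1 = z n - eta n + n.+1%:R^-1 *: (h (z n) + eta n).

Definition limit_set : set V :=
  [set p | forall eps n0, 0 < eps -> exists2 n, (n0 <= n)%N & `|z n - p| < eps].

Lemma scheme_from_tail (eps : R) : 0 < eps ->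
  \forall n \near \oo, scheme_from D h (@clock R) z eta eps n.
Proof.
move=> e0; move/cvgrPdist_le : eta0 => /(_ _ e0) [K _ HK].
near=> n => i ni; split.
- by apply: zD; apply: leq_trans ni; near: n; exists N.
- have := HK i; rewrite /= sub0r normrN; apply.
  by apply: leq_trans ni; near: n; exists K.
- by rewrite clockS lerDl.
- have -> : clock R i.+1 - clock R i = i.+1%:R^-1.
    by rewrite clockS addrAC subrr add0r.
  apply: zS.
  by apply: leq_trans ni; near: n; exists N.
Unshelve. all: by end_near. Qed.

Lemma limit_set_sub : closed D -> limit_set `<=` D.
Proof.
move=> clD p Lp; apply: clD => B /nbhs_ballP[r r0 rB].
have [n Nn pn] := Lp r N r0; exists (z n); split; first exact: zD.
by apply: rB; rewrite -ball_normE /= distrC.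
Qed.

Lemma closed_limit_set : closed limit_set.
Proof.
move=> p cp eps n0 e0.
have e20 : 0 < eps / 2 by rewrite divr_gt0.
have [q [Lq]] := cp _ (nbhsx_ballx p _ e20).
rewrite -ball_normE /= => pq.
have [n nn0 zq] := Lq (eps / 2) n0 e20; exists n => //.
rewrite -(subrK q (z n)) -addrA (le_lt_trans (ler_normD _ _))//.
by rewrite [eps]splitr ltrD// distrC.
Qed.

(** Choose indices [phi n] tending to infinity with [z (phi n)] close to [u], and read
the sequence from time [clock (phi n)] on: this gives a scheme which in the limit
covers all real times, past ones included.  The values of the limit are limits
of points of [z] with indices going to infinity, hence lie in the limit set. *)
Lemma limit_set_solution u : limit_set u -> exists x : R -> V,
  [/\ x 0 = u, forall t, limit_set (x t) &
    forall t t', `|x t' - x t - (t' - t) *: h (x t)|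
       <= 2 * L * M * (t' - t) ^+ 2].
Proof.
move=> Lu; have [F FU Foo] := free_ultrafilter_nat.
have /choice[phi Hphi] : forall n : nat, exists m, (n <= m)%N /\ `|z m - u| < n.+1%:R^-1.
  move=> n; have n0 : (0 : R) < n.+1%:R^-1 by rewrite invr_gt0.
  by have [m nm zm] := Lu _ n n0; exists m.
have jphi j : (j <= phi j)%N := (Hphi j).1.
pose a n (t : R) := index_at (clock R (phi n) + t).
have ainfty t K : \forall n \near F, (K < a n t)%N.
  apply: Foo; apply: filterS (clock_shift_infty t K jphi) => j.
  exact: lt_index_at.
have [t eps _ e0|n t t' tt'|t _|x [x1 x2]] :=
  @scheme_ultralimit R V D h L M cD L0 hlip hbd F FU setT (fun=> z) (fun=> eta)
  (fun=> clock R) (fun n => clock R (phi n)) a.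
- have [K _ HK] := scheme_from_tail e0.
  apply: filterS (ainfty t K) => n /= /ltnW Kn i ni.
  by apply: (HK K) => //=; exact: leq_trans ni.
- by apply: index_at_homo; rewrite lerD2l.
- apply/cvgrPdist_le => e e0.
  have [K _ HK] := @near_infty_natSinv_lt R (PosNum e0).
  apply: Foo; apply: filterS (clock_shift_infty t K jphi) => n Kn.
  have h1 := index_atP (clock R (phi n) + t).
  have h2 := index_at_overshoot Kn.
  have /= h3 := HK K (leqnn K).
  rewrite /a distrC; move: h1 h2 h3; set A := clock _ (index_at _).
  set B := clock _ _; set C := K.+1%:R^-1 => h1 h2 h3.
  have h0 : A - B - t <= e :> R by rewrite -addrA -opprD lerBlDl (le_trans h2)// lerD2l ltW.
  by rewrite ger0_norm// -addrA -opprD subr_ge0.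
have xF t : z (a n t) @[n --> F] --> x t := (x1 t I).2.
exists x; split => [|t eps n0 e0|t t']; last exact: x2.
  have cu : z (a n 0) @[n --> F] --> u.
    apply/cvgrPdist_le => e e0.
    have [K _ HK] := @near_infty_natSinv_lt R (PosNum e0).
    apply: Foo; exists K => // n /= Kn.
    rewrite /a addr0 index_at_clock distrC (le_trans (ltW (Hphi n).2))//.
    exact/ltW/HK.
  exact: (cvg_unique (@norm_hausdorff _ V) (xF 0) cu).
have /cvgrPdist_lt/(_ _ e0) H := xF t.
have [n [Hn Kn]] := filter_ex (filterI H (ainfty t n0)).
by exists (a n t); [exact: ltnW | rewrite distrC].
Qed.

Hypothesis clD : closed D.

Lemma limit_set_the_solution u : limit_set u -> exists x : R -> V,
  [/\ the_solution D h setT u x, forall t, limit_set (x t) &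
    forall t t', `|x t' - x t - (t' - t) *: h (x t)|
       <= 2 * L * M * (t' - t) ^+ 2].
Proof.
move=> Lu; have [x [x0 xL x2]] := limit_set_solution Lu.
have xS : ode_solution D h setT u x.
  split => // t _; split; first exact: limit_set_sub.
  by apply: (@is_derive_quadratic _ _ _ _ (2 * L * M)); near=> s; exact: x2.
exists x; split => //; split => // y yS t _.
exact: huniq xS yS t.
Unshelve. all: by end_near. Qed.

End LimitSet.

(** * Shadowing *)

Section Tracking.
Context (R : realType) (V : normedModType R).
Variables (D : set V) (h : V -> V) (L : R).
Hypothesis L0 : 0 <= L.
Hypothesis hlip : forall u v, D u -> D v -> `|h u - h v| <= L * `|u - v|.

Lemma tracking_split (W : zmodType) (x y q v X : W) :
  x + q - X = (x - y + (q - v)) - (X - y - v).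
Proof.
rewrite opprB [v - _]addrC opprB -[RHS]addrA [q - v + _]addrCA subrK.
by rewrite [y - X + q]addrAC addrA subrKA.
Qed.

(** A discrete Gronwall inequality: one step multiplies the distance between scheme
and solution by at most [1 + L w <= expR (L w)], where [w] is the step, and adds
[w] times the perturbation plus the local error [C w^2 <= C g w]. *)
Lemma scheme_tracking (s : nat -> R) (p e : nat -> V) eps g C (x : R -> V) a b :
  scheme_from D h s p e eps a -> (forall i, (a <= i)%N -> s i.+1 - s i <= g) ->
  0 <= C -> (forall t, D (x t)) ->
  (forall t t', `|x t' - x t - (t' - t) *: h (x t)| <= C * (t' - t) ^+ 2) ->
  (a <= b)%N ->
  `|p b - e b - x (s b - s a)| <= expR (L * (s b - s a)) *
    (`|p a - e a - x 0| + (s b - s a) * ((L + 1) * eps + C * g)).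
Proof.
move=> H Hg C0 xD xq ab.
have [_ ea sa _] := H a (leqnn a).
have eps0 : 0 <= eps by rewrite (le_trans _ ea).
have g0 : 0 <= g by rewrite (le_trans _ (Hg a (leqnn a)))// subr_ge0.
set B := (L + 1) * eps + C * g.
have B0 : 0 <= B by rewrite addr_ge0// mulr_ge0// addr_ge0.
set E0 := `|p a - e a - x 0|.
have E00 : 0 <= E0 by rewrite normr_ge0.
move: ab => /subnKC <-; elim: (b - a)%N => [|n IH].
  by rewrite addn0 !subrr mulr0 expR0 mul1r mul0r addr0.
rewrite addnS; have [Dp ep sp ->] := H (a + n)%N (leq_addr _ _).
have gS := Hg (a + n)%N (leq_addr _ _).
set c := (a + n)%N in Dp ep sp gS IH *.
have sac : s a <= s c by apply: (scheme_le H); exact: leq_addr.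
set w := s c.+1 - s c in gS *.
set d := s c - s a in IH *.
set y := x d in IH *.
have w0 : 0 <= w by rewrite subr_ge0.
have d0 : 0 <= d by rewrite subr_ge0.
have dS : s c.+1 - s a = d + w by rewrite /d /w [RHS]addrC subrKA.
rewrite dS.
have -> : p c - e c + w *: (h (p c) + e c) - x (d + w) =
  (p c - e c - y + w *: (h (p c) - h y + e c)) - (x (d + w) - y - w *: h y).
  by rewrite [h (p c) - h y + e c]addrAC scalerBr; exact: tracking_split.
set dn := `|p c - e c - y| in IH *.
have N1 : `|h (p c) - h y + e c| <= L * (dn + eps) + eps.
  rewrite (le_trans (ler_normD _ _))// lerD// (le_trans (hlip Dp (xD d)))// -/y.
  have -> : p c - y = p c - e c - y + e c by rewrite addrAC subrK.
  by rewrite ler_wpM2l// (le_trans (ler_normD _ _))// lerD.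
have N2 : `|x (d + w) - y - w *: h y| <= C * g * w.
  have := xq d (d + w); rewrite [d + w - d]addrAC subrr add0r => /le_trans; apply.
  by rewrite -mulrA ler_wpM2l// expr2 ler_wpM2r.
have N3 : `|p c - e c - y + w *: (h (p c) - h y + e c) -
    (x (d + w) - y - w *: h y)| <= dn * (1 + L * w) + w * B.
  rewrite (le_trans (ler_normB _ _))//.
  rewrite (le_trans (lerD (ler_normD _ _) N2))//.
  rewrite normrZ ger0_norm//.
  have := ler_wpM2l w0 N1.
  rewrite /B -/dn; lra.
apply: le_trans N3 _.
have ex0 : 1 + L * w <= expR (L * w) := expR_ge1Dx _.
have Lw0 : 0 <= L * w by rewrite mulr_ge0.
have eq1 : expR (L * (d + w)) = expR (L * d) * expR (L * w).
  by rewrite mulrDr expRD.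
have E1 : 1 <= expR (L * (d + w)).
  by rewrite -expR0 ler_expR mulr_ge0// addr_ge0.
have -> : expR (L * (d + w)) * (E0 + (d + w) * B) =
  expR (L * (d + w)) * (E0 + d * B) + expR (L * (d + w)) * (w * B) by ring.
apply: lerD; last first.
  by rewrite -[leLHS]mul1r ler_wpM2r// mulr_ge0.
rewrite eq1 mulrAC; by apply: ler_pM => //; [exact: normr_ge0|rewrite addr_ge0].
Qed.

End Tracking.

(** * Connectedness and chain transitivity of the limit set *)

Section LimitSetProperties.
Context (R : realType) (V : normedModType R).
Variables (D : set V) (h : V -> V) (L M : R).
Hypothesis cD : compact D.
Hypothesis clD : closed D.
Hypothesis L0 : 0 <= L.
Hypothesis hlip : forall u v, D u -> D v -> `|h u - h v| <= L * `|u - v|.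
Hypothesis hbd : forall u, D u -> `|h u| <= M.
Hypothesis huniq : forall u x y, ode_solution D h setT u x ->
  ode_solution D h setT u y -> forall t, y t = x t.

Variables (z eta : nat -> V) (N : nat).
Hypothesis zD : forall n, (N <= n)%N -> D (z n).
Hypothesis eta0 : eta @ \oo --> (0 : V).
Hypothesis zS : forall n, (N <= n)%N ->
  z n.+1 - eta n.+1 = z n - eta n + n.+1%:R^-1 *: (h (z n) + eta n).

Local Notation limz := (limit_set z).

(** Otherwise a subsequence would stay away from the limit set, although by
compactness of [D] it accumulates at one of its points. *)
Lemma near_limit_set (eps : R) : 0 < eps ->
  \forall n \near \oo, exists2 l, limz l & `|z n - l| < eps.
Proof.
move=> e0; apply: contrapT => Hn.
have /choice[phi Hphi] : forall K : nat, exists n, (K <= n)%N /\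
    ~ (exists2 l, limz l & `|z n - l| < eps).
  move=> K; apply: contrapT => HK; apply: Hn; exists K => // n /= Kn.
  by apply: contrapT => Hz; apply: HK; exists n.
have [F FU Foo] := free_ultrafilter_nat.
have FD : \forall n \near F, D (z (phi n)).
  apply: Foo; exists N => // n /= Nn; apply: zD.
  exact: leq_trans Nn (Hphi n).1.
have [l Dl /cvgrPdist_lt cl] := ultra_cvg cD FU FD.
have Ll : limz l.
  move=> d n0 d0.
  have ge_n0 : \forall n \near F, (n0 <= n)%N by apply: Foo; exists n0.
  have [n [ln n0n]] := filter_ex (filterI (cl _ d0) ge_n0).
  by exists (phi n); [exact: leq_trans n0n (Hphi n).1|rewrite distrC].
have [n ln] := filter_ex (cl _ e0).
by apply: (Hphi n).2; exists l => //; rewrite distrC.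
Qed.

Lemma limit_set_nonempty : limz !=set0.
Proof.
by have [n [l Ll _]] := filter_ex (near_limit_set ltr01); exists l.
Qed.

Lemma compact_limit_set : compact limz.
Proof.
apply: subclosed_compact cD _; first exact: closed_limit_set.
exact: limit_set_sub zD clD.
Qed.

Lemma converges_to_limit_set : converges_to_set z limz.
Proof.
split; first exact: limit_set_nonempty.
apply/cvgrPdist_lt => e e0; apply: filterS (near_limit_set e0) => n [l Ll zl].
have lb0 : lbound [set `|z n - y| | y in limz] 0 by move=> _ [y _ <-].
rewrite sub0r normrN ger0_norm; last first.
  by apply: lb_le_inf => //; exists `|z n - l|; exists l.
apply: le_lt_trans zl; apply: ge_inf; first by exists 0.
by exists l.
Qed.

Lemma vanishing_increment (e : R) : 0 < e ->
  \forall n \near \oo, `|z n.+1 - z n| < e.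
Proof.
move=> e0.
have M0 : 0 <= M by apply: le_trans (normr_ge0 _) (hbd (zD (leqnn N))).
have d0 : 0 < e / (2 * (M + e + 2)).
  by rewrite divr_gt0// mulr_gt0// ltr_wpDl// addr_ge0// ltW.
have e40 : 0 < e / 8 by rewrite divr_gt0.
(* the perturbation contributes e / 4 to the bound of scheme_increment *)
have H1 := scheme_from_tail zD eta0 zS e40.
have H2 := near_infty_natSinv_lt (PosNum d0).
near=> n.
have S1 : scheme_from D h (clock R) z eta (e / 8) n by near: n.
have S2 : n.+1%:R^-1 < e / (2 * (M + e + 2)) by near: n.
have := scheme_increment hbd S1 (leqnSn n).
rewrite clockS [clock _ _ + _ - _]addrAC subrr add0r => /le_lt_trans; apply.
have Me : 0 < M + e / 8 by rewrite ltr_wpDl.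
have : (M + e / 8) * n.+1%:R^-1 <= e / 2.
  apply: le_trans (ler_wpM2l (ltW Me) (ltW S2)) _.
  rewrite mulrA ler_pdivrMr; last by rewrite mulr_gt0// ltr_wpDl// addr_ge0// ltW.
  have := mulr_ge0 (ltW e0) (ltW e0); have := mulr_ge0 M0 (ltW e0); lra.
set X := (_ * _) => HX; have : X + 2 * (e / 8) = X + e / 4 by field.
by move=> ->; lra.
Unshelve. all: by end_near. Qed.

(** A sequence of counterexamples with gaps [1 / (n + 1)] would accumulate at a point
of [B] that is not interior to [C]. *)
Lemma compact_open_gap (B C : set V) : compact B -> open C -> B `<=` C ->
  exists2 r : R, 0 < r & forall b y, B b -> `|b - y| < r -> C y.
Proof.
move=> cB oC BC; apply: contrapT => H.
have /choice[f Hf] : forall n : nat, exists by' : V * V,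
    [/\ B by'.1, `|by'.1 - by'.2| < n.+1%:R^-1 & ~ C by'.2].
  move=> n; apply: contrapT => Hn; apply: H; exists n.+1%:R^-1.
    by rewrite invr_gt0.
  move=> b y Bb byn; apply: contrapT => nC; apply: Hn.
  by exists (b, y).
have [F FU Foo] := free_ultrafilter_nat.
have FB : \forall n \near F, B (f n).1.
  by apply: nearW => n; have [] := Hf n.
have [b Bb /cvgrPdist_lt cb] := ultra_cvg cB FU FB.
have /nbhs_ballP[r r0 rC] : nbhs b C by apply: open_nbhs_nbhs; split => //; exact: BC.
have r20 : 0 < r / 2 by rewrite divr_gt0.
have Fr : \forall n \near F, n.+1%:R^-1 < r / 2.
  exact/Foo/(near_infty_natSinv_lt (PosNum r20)).
have [n [bn rn]] := filter_ex (filterI (cb _ r20) Fr).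
have [_ fn] := Hf n; apply; apply: rC; rewrite -ball_normE /=.
rewrite -(subrK (f n).1 b) -addrA (le_lt_trans (ler_normD _ _))//.
by rewrite [r]splitr ltrD// (lt_trans fn).
Qed.

(** A proper clopen part [B] of the limit set has a positive distance to the rest of
it.  As the increments of [z] vanish and [z] approaches the limit set, once [z]
is near [B] it can never leave the neighbourhood of [B], so the limit set has no
point outside [B]. *)
Lemma connected_limit_set : connected limz.
Proof.
move=> B [b0 Bb0] [C oC BC] [C' clC' BC'].
have BL : B `<=` limz by rewrite BC; exact: subIsetl.
apply/seteqP; split => // l Ll; apply: contrapT => nBl.
have cB : compact B.
  by rewrite BC'; apply: compact_closedI => //; exact: compact_limit_set.
have BsubC : B `<=` C by rewrite BC; exact: subIsetr.
have [r r0 Hr] := compact_open_gap cB oC BsubC.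
have {}Hr b y : B b -> limz y -> `|b - y| < r -> B y.
  by move=> Bb Ly /(Hr _ _ Bb) Cy; rewrite BC.
have r30 : 0 < r / 3 by rewrite divr_gt0.
have [K _ HK] := filterI (near_limit_set r30) (vanishing_increment r30).
have [n0 Kn0 zb0] := BL _ Bb0 (r / 3) K r30.
have stay n : (n0 <= n)%N -> exists2 b, B b & `|z n - b| < r / 3.
  move=> /subnKC <-; elim: (n - n0)%N => [|m [b Bb zb]].
    by rewrite addn0; exists b0.
  rewrite addnS; set i := (n0 + m)%N in zb *.
  have Ki : (K <= i)%N by rewrite (leq_trans Kn0)// leq_addr.
  have [[l' Ll' zl'] _] := HK i.+1 (leqW Ki).
  have [_ zz] := HK i Ki.
  exists l' => //; apply: (Hr b) => //.
  have -> : b - l' = (b - z i) + (z i - z i.+1) + (z i.+1 - l').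
    by rewrite addrA !subrKA subrK.
  rewrite (le_lt_trans (ler_normD _ _))//.
  rewrite (le_lt_trans (lerD (ler_normD _ _) (lexx _)))//.
  by move: zb zz zl'; rewrite (distrC b) (distrC (z i) (z i.+1)); lra.
have [m n0m zl] := Ll (r / 3) n0 r30.
have [b Bb zb] := stay m n0m.
apply: nBl; apply: (Hr b) => //.
have -> : b - l = (b - z m) + (z m - l) by rewrite subrKA.
rewrite (le_lt_trans (ler_normD _ _))//.
by move: zb zl; rewrite (distrC b); lra.
Qed.

(** [scheme_tracking] with perturbation, step and initial distance all bounded by the
same [d]: on a time interval of length at most [T] the distance is then at most
a constant times [d]. *)
Lemma uniform_tracking (T e : R) : 0 < T -> 0 < e -> exists2 d, 0 < d &
  \forall n \near \oo, forall m x, (n <= m)%N -> clock R m - clock R n <= T ->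
    (forall t, D (x t)) ->
    (forall t t', `|x t' - x t - (t' - t) *: h (x t)| <=
       2 * L * M * (t' - t) ^+ 2) ->
    `|z n - x 0| < d -> `|z m - x (clock R m - clock R n)| < e.
Proof.
move=> T0 e0.
have M0 : 0 <= M by apply: le_trans (normr_ge0 _) (hbd (zD (leqnn N))).
pose C := 2 * L * M.
have C0 : 0 <= C by rewrite !mulr_ge0.
(* [K] times [d] bounds the final distance when all the errors are at most [d] *)
pose K := expR (L * T) * (2 + T * (L + 1 + C)) + 1.
have LC0 : 0 <= L + 1 + C by rewrite !addr_ge0.
have K1 : 0 <= expR (L * T) * (2 + T * (L + 1 + C)).
  by rewrite mulr_ge0 ?expR_ge0// addr_ge0// mulr_ge0// ltW.
have K0 : 0 < K by rewrite /K ltr_wpDl.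
have d0 : 0 < e / (2 * K) by rewrite divr_gt0// mulr_gt0.
set d := e / (2 * K) in d0.
have dK : d * K < e.
  have -> : d * K = e / 2 by rewrite /d; field; rewrite gt_eqF.
  lra.
exists d => //.
near=> n => m x nm nmT xD xq zx.
have S1 : scheme_from D h (clock R) z eta d n.
  by near: n; exact: (scheme_from_tail zD eta0 zS d0).
have gd : n.+1%:R^-1 < d.
  by near: n; exact: (near_infty_natSinv_lt (PosNum d0)).
have Hg i : (n <= i)%N -> clock R i.+1 - clock R i <= d.
  move=> ni; rewrite clockS addrAC subrr add0r (le_trans _ (ltW gd))//.
  by rewrite lef_pV2 ?posrE ?ltr0n// ler_nat.
have [_ en _ _] := S1 n (leqnn n).
have [_ em _ _] := S1 m nm.
have := scheme_tracking L0 hlip S1 Hg C0 xD xq nm.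
set t := clock R m - clock R n in nmT *.
have t0 : 0 <= t by rewrite subr_ge0 clock_le.
set Y := `|z m - eta m - x t|; set Z := `|z n - eta n - x 0| => HY.
have HZ : Z <= 2 * d.
  rewrite /Z addrAC (le_trans (ler_normB _ _))//.
  by have := ltW zx; lra.
have HE : expR (L * t) <= expR (L * T) by rewrite ler_expR ler_wpM2l.
have HB : 0 <= (L + 1) * d + C * d by rewrite -mulrDl mulr_ge0// ltW.
have HI : Z + t * ((L + 1) * d + C * d) <= d * (2 + T * (L + 1 + C)).
  have -> : d * (2 + T * (L + 1 + C)) = 2 * d + T * ((L + 1) * d + C * d) by ring.
  by apply: lerD => //; rewrite ler_wpM2r.
have HY2 : Y <= d * (K - 1).
  apply: (le_trans HY); rewrite /K addrK [leRHS]mulrCA.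
  apply: ler_pM => //.
  by apply: addr_ge0; [exact: normr_ge0|exact: (mulr_ge0 t0 HB)].
have -> : z m - x t = (z m - eta m - x t) + eta m by rewrite addrAC subrK.
rewrite (le_lt_trans (ler_normD _ _))// (le_lt_trans _ dK)//.
rewrite (le_trans (lerD HY2 em))//; lra.
Unshelve. all: by end_near. Qed.

(** The chains of [internally_chain_transitive], with their two endpoints as
arguments so that they can be built link by link. *)
Definition chained (A : set V) (eps tmin : R) (u v : V) :=
  exists (m : nat) (c : nat -> V) (tau : nat -> R),
    [/\ (0 < m)%N, c 0%N = u, c m = v,
        forall i, (i <= m)%N -> A (c i) &
        forall i, (0 < i <= m)%N -> tmin <= tau i /\
          exists2 x, the_solution D h setT (c i.-1) x &
                     `|x (tau i) - c i| < eps].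

Lemma chained_link A eps tmin u v x t : A u -> A v ->
  the_solution D h setT u x -> tmin <= t -> `|x t - v| < eps ->
  chained A eps tmin u v.
Proof.
move=> Au Av xs tt xv.
exists 1%N, (fun i => if i == 0%N then u else v), (fun=> t); split => //.
  by case.
by move=> [//|[|//]] _; split => //; exists x.
Qed.

Lemma chained_cons A eps tmin u w v x t : A u ->
  the_solution D h setT u x -> tmin <= t -> `|x t - w| < eps ->
  chained A eps tmin w v -> chained A eps tmin u v.
Proof.
move=> Au xs tt xw [m [c [tau [m0 c0 cm cA cS]]]].
exists m.+1, (fun i => if i is j.+1 then c j else u),
  (fun i => if i is j.+2 then tau j.+1 else t); split => //.
  by move=> [//|i]; rewrite ltnS => /cA.
move=> [//|[_|i]] /=; first by split => //; exists x => //; rewrite c0.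
by rewrite ltnS => im; have [? ?] := cS i.+1 im.
Qed.

(** Links of the chain follow the flow for a time between [T] and [2 T + 1].  As long
as the time left is larger, the next cut is made at the first index whose time
exceeds the current one by [T]: since steps are at most 1, this overshoots by at
most 1 and leaves at least [T]. *)
Lemma chain_transitive_limit_set :
  internally_chain_transitive D h limz.
Proof.
split.
- split; first exact: limit_set_sub zD clD.
  move=> u Lu.
  have [x [xs xL _]] :=
    limit_set_the_solution cD L0 hlip hbd huniq zD eta0 zS clD Lu.
  by exists x.
- exact: compact_limit_set.
move=> u v eps T Lu Lv e0 T0.
have e20 : 0 < eps / 2 by rewrite divr_gt0.
have T20 : 0 < 2 * T + 1 by rewrite ltr_wpDl// mulr_ge0// ltW.
have [d1 d10 H1] := uniform_tracking T20 e20.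
pose d := Num.min d1 (eps / 2).
have d0 : 0 < d by rewrite lt_min d10.
have [n0 _ H] := filterI H1 (near_limit_set d0).
have shadow n m c x w : (n0 <= n)%N -> (n <= m)%N ->
    clock R m - clock R n <= 2 * T + 1 ->
    x 0 = c -> (forall t, D (x t)) ->
    (forall t t', `|x t' - x t - (t' - t) *: h (x t)| <=
       2 * L * M * (t' - t) ^+ 2) ->
    `|z n - c| < d -> `|z m - w| < d ->
    `|x (clock R m - clock R n) - w| < eps.
  move=> n0n nm hT x0 xD xq zc zw.
  have [Ht _] := H n n0n.
  have zd1 : `|z n - x 0| < d1 by rewrite x0 (lt_le_trans zc)// ge_min lexx.
  have zw2 : `|z m - w| < eps / 2 by rewrite (lt_le_trans zw)// ge_min lexx orbT.
  have := Ht m x nm hT xD xq zd1; set t := clock R m - _.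
  rewrite distrC => xz.
  have -> : x t - w = (x t - z m) + (z m - w) by rewrite subrKA.
  by rewrite (le_lt_trans (ler_normD _ _))// [eps]splitr ltrD.
(* induction on a bound of the number of indices left *)
have main k : forall n m c w, (n0 <= n)%N -> (m <= n + k)%N ->
    clock R n + T <= clock R m ->
    limz c -> limz w -> `|z n - c| < d -> `|z m - w| < d ->
    chained limz eps T c w.
  elim: k => [|k IH] n m c w n0n mk nTm Lc Lw zc zw.
    have := clock_le R mk; rewrite addn0; lra.
  have nm : (n < m)%N.
    by rewrite ltnNge; apply/negP => /(clock_le R); lra.
  have [x [xs xL xq]] :=
    limit_set_the_solution cD L0 hlip hbd huniq zD eta0 zS clD Lc.
  have x0 : x 0 = c by have [[]] := xs.
  have xD t : D (x t) := limit_set_sub zD clD (xL t).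
  have [short|long] := leP (clock R m - clock R n) (2 * T + 1).
    apply: (chained_link Lc Lw xs (_ : T <= clock R m - clock R n)); first lra.
    by apply: (shadow n m c) => //; exact: ltnW.
  have nT : clock R n < clock R n + T by rewrite ltrDl.
  pose i := index_at (clock R n + T).
  have ni : (n < i)%N := lt_index_at nT.
  have i1 : clock R n + T <= clock R i := index_atP _.
  have i2 : clock R i <= clock R n + T + 1.
    apply: le_trans (index_at_overshoot nT) _.
    by rewrite lerD2l invf_le1// ler1n.
  have [_ [l Ll zl]] := H i (leq_trans n0n (ltnW ni)).
  apply: (@chained_cons _ _ _ c l w x (clock R i - clock R n)) => //; first lra.
    by apply: (shadow n i c) => //; [exact: ltnW | lra].
  apply: (IH i m) => //; first exact: (leq_trans n0n (ltnW ni)).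
    by rewrite (leq_trans mk)// addnS -addSn leq_add2r.
  lra.
have [n n0n zu] := Lu d n0 d0.
have [K HK] := clock_unbounded (clock R n + T).
have [m Km zv] := Lv d K d0.
apply: (main m n m) => //; first exact: leq_addl.
by rewrite (le_trans HK)// clock_le.
Qed.

End LimitSetProperties.

(** * Uniqueness of solutions of Lipschitz equations in three dimensions *)

Lemma norm_triple (R : realType) (a b c : R) : `|(a, b, c) : R * R * R| =
  Num.max (Num.max `|a| `|b|) `|c|.
Proof. by []. Qed.

Lemma norm_triple_le (R : realType) (u : R * R * R) (r : R) :
  (`|u| <= r) = [&& `|u.1.1| <= r, `|u.1.2| <= r & `|u.2| <= r].
Proof. by case: u => [[a b] c]; rewrite norm_triple !ge_max andbA. Qed.

Section Uniqueness.
Context (R : realType).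

Lemma is_derive_fst (U V : normedModType R) (x : R -> U * V) (t : R) (v : U * V) :
  is_derive t 1 x v -> is_derive t 1 (fun s => (x s).1) v.1.
Proof.
move=> [dx <-]; suff cv : (fun h => h^-1 *: (((fun s => (x s).1) \o shift t) (h *: 1)
    - (x t).1)) @ 0^' --> ('D_1 x t).1.
  by apply: DeriveDef; [exact: cvgP cv|exact: cvg_lim cv].
have cx : (fun h => h^-1 *: ((x \o shift t) (h *: 1) - x t)) @ 0^' --> 'D_1 x t.
  exact: dx.
exact: (cvg_comp _ _ cx (@cvg_fst _ _ _ _ _)).
Qed.

Lemma is_derive_snd (U V : normedModType R) (x : R -> U * V) (t : R) (v : U * V) :
  is_derive t 1 x v -> is_derive t 1 (fun s => (x s).2) v.2.
Proof.
move=> [dx <-]; suff cv : (fun h => h^-1 *: (((fun s => (x s).2) \o shift t) (h *: 1)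
    - (x t).2)) @ 0^' --> ('D_1 x t).2.
  by apply: DeriveDef; [exact: cvgP cv|exact: cvg_lim cv].
have cx : (fun h => h^-1 *: ((x \o shift t) (h *: 1) - x t)) @ 0^' --> 'D_1 x t.
  exact: dx.
exact: (cvg_comp _ _ cx (@cvg_snd _ _ _ _ _)).
Qed.

(** [expR (- K t) * phi t] does not increase. *)
Lemma gronwall_zero (phi dphi : R -> R) (K : R) :
  (forall t : R, 0 <= t -> is_derive t 1 phi (dphi t)) ->
  (forall t : R, 0 <= t -> dphi t <= K * phi t) ->
  (forall t, 0 <= phi t) -> phi 0 = 0 -> forall t : R, 0 <= t -> phi t = 0.
Proof.
move=> dphiP dK phi0 phi00 t t0.
pose psi (s : R) : R := expR (- K * s) * phi s.
have dpsi (s : R) : 0 <= s -> is_derive s 1 psi (expR (- K * s) * (dphi s - K * phi s)).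
  move=> s0; have H := dphiP s s0.
  have E : is_derive s 1 (fun s : R => expR (- K * s)) (- K * expR (- K * s)).
    by apply: is_derive_eq; rewrite /GRing.scale /= !mulr1 mulrC.
  apply: is_derive_eq; rewrite /GRing.scale /=; ring.
have cpsi : {within `[0, t], continuous psi}.
  apply: derivable_within_continuous => s; rewrite in_itv /= => /andP[s0 _].
  by have [] := dpsi s s0.
have le : psi t <= psi 0.
  apply: (@ler0_derive1_le_cc _ psi 0 t) => //; rewrite ?in_itv /= ?lexx ?t0//.
  - by move=> s; rewrite in_itv /= => /andP[/ltW s0 _]; have [] := dpsi s s0.
  - move=> s; rewrite in_itv /= => /andP[/ltW s0 _].
    rewrite derive1E; have [_ ->] := dpsi s s0.
    by rewrite mulr_ge0_le0 ?expR_ge0// subr_le0 dK.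
apply/eqP; rewrite eq_le phi0 andbT.
move: le; rewrite /psi phi00 mulr0 pmulr_rle0 ?expR_gt0//.
Qed.

Variables (D : set (R * R * R)) (h : R * R * R -> R * R * R) (L : R).
Hypothesis hlip : forall u v, D u -> D v -> `|h u - h v| <= L * `|u - v|.

Let dist2 (x y : R -> R * R * R) (t : R) :=
  ((y t).1.1 - (x t).1.1) ^+ 2 + ((y t).1.2 - (x t).1.2) ^+ 2 +
  ((y t).2 - (x t).2) ^+ 2.

Let ddist2 (x y : R -> R * R * R) (t : R) :=
  2 * (((y t).1.1 - (x t).1.1) * ((h (y t)).1.1 - (h (x t)).1.1) +
       ((y t).1.2 - (x t).1.2) * ((h (y t)).1.2 - (h (x t)).1.2) +
       ((y t).2 - (x t).2) * ((h (y t)).2 - (h (x t)).2)).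

Let is_derive_dist2 x y (t : R) : is_derive t 1 x (h (x t)) ->
  is_derive t 1 y (h (y t)) -> is_derive t 1 (dist2 x y) (ddist2 x y t).
Proof.
move=> dx dy.
have x1 := is_derive_fst (is_derive_fst dx).
have x2 := is_derive_snd (is_derive_fst dx).
have x3 := is_derive_snd dx.
have y1 := is_derive_fst (is_derive_fst dy).
have y2 := is_derive_snd (is_derive_fst dy).
have y3 := is_derive_snd dy.
apply: is_derive_eq; rewrite /ddist2 /GRing.scale /=; ring.
Qed.

Let norm_triple_sq (u : R * R * R) : `|u| ^+ 2 <= u.1.1 ^+ 2 + u.1.2 ^+ 2 + u.2 ^+ 2.
Proof.
case: u => [[a b] c]; rewrite norm_triple /=.
have := sqr_ge0 a; have := sqr_ge0 b; have := sqr_ge0 c.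
by rewrite /Num.max; do 2?[case: ifP => _]; rewrite real_normK ?num_real//; lra.
Qed.

Let ddist2_le x y t : D (x t) -> D (y t) ->
  `|ddist2 x y t| <= 6 * `|L| * dist2 x y t.
Proof.
move=> Dx Dy; rewrite /ddist2 /dist2.
have := lexx `|y t - x t|; rewrite {1}norm_triple_le => /and3P[d1 d2 d3].
have := lexx `|h (y t) - h (x t)|; rewrite {1}norm_triple_le => /and3P[h1 h2 h3].
have hl : `|h (y t) - h (x t)| <= `|L| * `|y t - x t|.
  by rewrite (le_trans (hlip Dy Dx))// ler_wpM2r// ler_norm.
have := norm_triple_sq (y t - x t).
set m := `|y t - x t| in d1 d2 d3 hl *.
have P (a b : R) : `|a| <= m -> `|b| <= `|h (y t) - h (x t)| ->
    `|a * b| <= `|L| * m ^+ 2.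
  move=> am bm; rewrite normrM (le_trans (ler_pM _ _ am (le_trans bm hl)))//.
  by rewrite expr2 mulrCA mulrA.
have p1 := P _ _ d1 h1; have p2 := P _ _ d2 h2; have p3 := P _ _ d3 h3.
move=> /= /(ler_wpM2l (normr_ge0 L)).
rewrite normrM ger0_norm// => q.
move: p1 p2 p3 q => /= p1 p2 p3 q.
set A := (X in `|X + _ + _|); set B := (X in `|_ + X + _|).
set C := (X in `|_ + _ + X|).
have := ler_normD (A + B) C; have := ler_normD A B.
rewrite -/A -/B -/C in p1 p2 p3.
lra.
Qed.

Let dist2_eq0 x y (t : R) : dist2 x y t = 0 -> y t = x t.
Proof.
rewrite /dist2 => /eqP; rewrite paddr_eq0 ?addr_ge0 ?sqr_ge0//.
rewrite paddr_eq0 ?sqr_ge0// !sqrf_eq0 !subr_eq0 => /andP[/andP[]].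
by case: (x t) (y t) => [[? ?] ?] [[? ?] ?] /= /eqP-> /eqP-> /eqP->.
Qed.

(** The squared Euclidean distance of two solutions satisfies the differential
inequality of [gronwall_zero]; the norm of the product space is a maximum and
is not differentiable. *)
Lemma ode_solution_unique_forward u x y :
  ode_solution D h [set t | 0 <= t] u x ->
  ode_solution D h [set t | 0 <= t] u y -> forall t : R, 0 <= t -> y t = x t.
Proof.
move=> [x0 xS] [y0 yS] t t0.
have z0 : dist2 x y t = 0.
  apply: (@gronwall_zero (dist2 x y) (ddist2 x y) (6 * `|L|)) => //.
  - by move=> s s0; apply: is_derive_dist2; [have [] := xS s s0|have [] := yS s s0].
  - move=> s s0; rewrite (le_trans (ler_norm _))// ddist2_le//.
      by have [] := xS s s0.
    by have [] := yS s s0.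
  - by move=> s; rewrite /dist2 !addr_ge0// sqr_ge0.
  - by rewrite /dist2 x0 y0 !subrr !expr0n /= !addr0.
exact: dist2_eq0 z0.
Qed.

(** For negative times, [gronwall_zero] is applied to the time-reversed distance. *)
Lemma ode_solution_unique u x y : ode_solution D h setT u x ->
  ode_solution D h setT u y -> forall t, y t = x t.
Proof.
move=> [x0 xS] [y0 yS] t.
have [t0|/ltW t0] := leP 0 t.
  apply: (@ode_solution_unique_forward u) => //; split => // s _.
    exact: xS.
  exact: yS.
have z0 : dist2 x y (- - t) = 0.
  apply: (@gronwall_zero (dist2 x y \o -%R) (fun s => - ddist2 x y (- s))
     (6 * `|L|)) => //; last by rewrite oppr_ge0.
  - move=> s s0.
    have H : is_derive (- s) 1 (dist2 x y) (ddist2 x y (- s)).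
      by apply: is_derive_dist2; [have [] := xS (- s) I|have [] := yS (- s) I].
    apply: is_derive_eq; rewrite /GRing.scale /=; ring.
  - move=> s s0; rewrite (le_trans (ler_norm _))// normrN ddist2_le//.
      by have [] := xS (- s) I.
    by have [] := yS (- s) I.
  - by move=> s; rewrite /= /dist2 !addr_ge0// sqr_ge0.
  - by rewrite /= oppr0 /dist2 x0 y0 !subrr !expr0n /= !addr0.
by apply: dist2_eq0; rewrite opprK in z0.
Qed.

End Uniqueness.

(** * Binomial means *)

Section BinomialMean.
Context (R : realType) (k : nat).
Implicit Types (q : R) (F G : nat -> R).

(** The integral is over all natural numbers and [F] is unrestricted there, so its
positive and negative parts are summed separately. *)
Lemma binomial_meanE q F : 0 <= q <= 1 ->
  binomial_mean k q F = \sum_(y < k.+1) binomial_pmf k q y * F y.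
Proof.
move=> /andP[q0 q1]; rewrite /binomial_mean unlock integralE.
have pos G : (forall y, 0 <= G y) ->
    (\int[binomial_prob k q]_y (G y)%:E)%E =
    (\sum_(y < k.+1) binomial_pmf k q y * G y)%:E.
  move=> G0; rewrite (@integral_binomial _ _ _ q0 q1); last first.
    by move=> y; rewrite lee_fin.
  by rewrite -sumEFin; apply: eq_bigr => y _; rewrite EFinM.
rewrite (eq_integral (fun y => (Num.max (F y) 0)%:E)); last first.
  by move=> y _; rewrite funeposE /= EFin_max.
rewrite [X in (_ - X)%E](eq_integral (fun y => (Num.max (- F y) 0)%:E)); last first.
  by move=> y _; rewrite funenegE /= EFin_max EFinN.
rewrite !pos; try by move=> y; rewrite le_max lexx orbT.
rewrite -EFinB /= -sumrB; apply: eq_bigr => y _.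
rewrite -mulrBr; congr (_ * _).
by case: (leP (F y) 0) => F0; case: (leP (- F y) 0); lra.
Qed.

Lemma binomial_mean_cst q c : 0 <= q <= 1 -> binomial_mean k q (fun=> c) = c.
Proof.
move=> q01; rewrite /binomial_mean.
by rewrite (@expectation_cst _ _ _ (binomial_prob k q) c).
Qed.

Lemma le_binomial_mean q F G : 0 <= q <= 1 ->
  (forall y, (y <= k)%N -> F y <= G y) ->
  binomial_mean k q F <= binomial_mean k q G.
Proof.
move=> q01 FG; rewrite !binomial_meanE//; apply: ler_sum => y _.
by rewrite ler_wpM2l ?binomial_pmf_ge0// FG// -ltnS.
Qed.

Lemma binomial_mean_itv q F a b : 0 <= q <= 1 ->
  (forall y, (y <= k)%N -> a <= F y <= b) -> a <= binomial_mean k q F <= b.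
Proof.
move=> q01 Fab; apply/andP; split.
  rewrite -[leLHS](binomial_mean_cst a q01).
  by rewrite le_binomial_mean// => y /Fab /andP[].
rewrite -[leRHS](binomial_mean_cst b q01).
by rewrite le_binomial_mean// => y /Fab /andP[].
Qed.

Lemma lipschitz_mul (a b c d : R) : 0 <= b <= 1 -> 0 <= c <= 1 ->
  `|a * b - c * d| <= `|a - c| + `|b - d|.
Proof.
move=> /andP[b0 b1] /andP[c0 c1].
have -> : a * b - c * d = (a - c) * b + c * (b - d) by ring.
rewrite (le_trans (ler_normD _ _))// !normrM (ger0_norm b0) (ger0_norm c0).
by rewrite lerD// ?ler_piMr// ler_piMl.
Qed.

Lemma lipschitz_expr (a b : R) n : 0 <= a <= 1 -> 0 <= b <= 1 ->
  `|a ^+ n - b ^+ n| <= n%:R * `|a - b|.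
Proof.
move=> a01 b01; elim: n => [|n IH]; first by rewrite !expr0 subrr normr0 mul0r.
rewrite !exprS (le_trans (lipschitz_mul _ _ _ _))//.
  by case/andP: a01 => a0 a1; rewrite exprn_ge0// exprn_ile1.
by rewrite -natr1 mulrDl mul1r addrC lerD2r.
Qed.

Lemma lipschitz_binomial_mean F : exists2 K, 0 <= K & forall a b,
  0 <= a <= 1 -> 0 <= b <= 1 ->
  `|binomial_mean k a F - binomial_mean k b F| <= K * `|a - b|.
Proof.
exists (\sum_(y < k.+1) (y%:R + (k - y)%:R) *+ 'C(k, y) * `|F y|).
  by apply: sumr_ge0 => y _; rewrite mulr_ge0// mulrn_wge0.
move=> a b a01 b01; rewrite !binomial_meanE// -sumrB.
rewrite (le_trans (ler_norm_sum _ _ _))// mulr_suml; apply: ler_sum => y _.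
rewrite -mulrBl normrM [leRHS]mulrAC ler_wpM2r// -mulrnBl normrMn mulrnAl lerMn2r.
apply/orP; right.
have unit01 (c : R) n : 0 <= c <= 1 -> 0 <= c ^+ n <= 1.
  by case/andP => c0 c1; rewrite exprn_ge0// exprn_ile1.
have onem01 (c : R) : 0 <= c <= 1 -> 0 <= 1 - c <= 1.
  by case/andP => c0 c1; rewrite subr_ge0 c1 gerBl.
change (`|a ^+ y * (1 - a) ^+ (k - y) - b ^+ y * (1 - b) ^+ (k - y)| <=
  (y%:R + (k - y)%:R) * `|a - b|).
rewrite (le_trans (lipschitz_mul _ _ _ _)) ?unit01 ?onem01//.
rewrite mulrDl lerD ?lipschitz_expr//.
rewrite (le_trans (lipschitz_expr _ _ _)) ?onem01//.
have -> : 1 - a - (1 - b) = b - a by ring.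
by rewrite distrC.
Qed.

End BinomialMean.

(** * The drift on the state space *)

Lemma convex_step (R : pzRingType) (W : lmodType R) (d : R) (x u : W) :
  x + d *: u = (1 - d) *: x + d *: (u + x).
Proof. by rewrite scalerBl scale1r scalerDr [d *: u + _]addrC subrKA. Qed.

Section DriftField.
Context (R : realType) (k : nat) (hk : (0 < k)%N) (beta : R) (beta0 : 0 < beta).
Variable (g : R -> R).
Hypothesis g01 : forall x, 0 <= x <= 1 -> 0 <= g x <= 1.

Local Notation S := (state_space k : set (R * R * R)).
Local Notation h := (drift k beta g).

Let k0 : (0 : R) < k%:R. Proof. by rewrite ltr0n. Qed.

Let gy y : (y <= k)%N -> 0 <= g (y%:R / k%:R) <= 1.
Proof.
move=> yk; apply: g01; rewrite divr_ge0 ?ler0n//=.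
by rewrite ler_pdivrMr// mul1r ler_nat.
Qed.

Lemma qbeta01 x : S x -> 0 <= qbeta beta x <= 1.
Proof.
case: x => [[a b] c] /= [/andP[a0 a1] /andP[b0 b1] /andP[c0 c1] bc].
have cb : 0 < c + beta by rewrite ltr_wpDl.
rewrite divr_ge0/=; last 2 first.
- by rewrite addr_ge0// mulr_ge0// ltW.
- exact: ltW.
by rewrite ler_pdivrMr// mul1r lerD// ger_pMr.
Qed.

(** [h x + x] is the vector [(H1, H2, H3)], so the state space is mapped into itself
by [h + id]; being convex, it is then preserved by Euler steps. *)
Lemma drift_target x : S x -> S (drift k beta g x + x).
Proof.
move=> Sx; have q01 := qbeta01 Sx; rewrite /drift subrK /=.
have h2 : 0 <= H2 k beta g x <= k%:R.
  apply: binomial_mean_itv => // y yk; have /andP[g0 g1] := gy yk.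
  by rewrite mulr_ge0//= (le_trans (ler_piMr _ g1))// ler_nat.
have h3 : 0 <= H3 k beta g x <= k%:R.
  apply: binomial_mean_itv => // y yk; have /andP[g0 g1] := gy yk.
  have yk' : (y%:R : R) <= k%:R by rewrite ler_nat.
  have p1 : 0 <= (k%:R - y%:R) * (1 - g (y%:R / k%:R)).
    by rewrite mulr_ge0// subr_ge0.
  have p2 : 0 <= y%:R * g (y%:R / k%:R) by rewrite mulr_ge0.
  rewrite addr_ge0//=.
  have p3 : y%:R * g (y%:R / k%:R) <= y%:R by rewrite ler_piMr.
  have p4 : (k%:R - y%:R) * (1 - g (y%:R / k%:R)) <= k%:R - y%:R.
    by rewrite ler_piMr ?subr_ge0// gerBl.
  lra.
split => //.
  by apply: binomial_mean_itv => // y yk; exact: gy.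
apply: le_binomial_mean => // y yk; have /andP[g0 g1] := gy yk.
by rewrite lerDl mulr_ge0// subr_ge0// ler_nat.
Qed.

Lemma drift_step x d : S x -> 0 <= d <= 1 -> S (x + d *: drift k beta g x).
Proof.
move=> Sx /andP[d0 d1].
have St := drift_target Sx.
have -> : x + d *: drift k beta g x =
    (1 - d) *: x + d *: (drift k beta g x + x).
  exact: convex_step.
case: x Sx (_ + x) St => [[a b] c] /=.
move=> [/andP[a0 a1] /andP[b0 b1] /andP[c0 c1] bc] [[a' b'] c'] /=.
move=> [/andP[a'0 a'1] /andP[b'0 b'1] /andP[c'0 c'1] bc'].
have e0 : 0 <= 1 - d by rewrite subr_ge0.
have conv (x y lo up : R) : lo <= x <= up -> lo <= y <= up ->
    lo <= (1 - d) * x + d * y <= up.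
  move=> /andP[x0 x1] /andP[y0 y1].
  have := ler_wpM2l e0 x0; have := ler_wpM2l e0 x1.
  have := ler_wpM2l d0 y0; have := ler_wpM2l d0 y1 => ? ? ? ?.
  by apply/andP; split; lra.
split; [apply: conv|apply: conv|apply: conv|]; rewrite ?a0 ?b0 ?c0 ?a'0 ?b'0 ?c'0 //.
by rewrite lerD// ler_wpM2l.
Qed.

Lemma drift_bounded x : S x -> `|drift k beta g x| <= k%:R + 1.
Proof.
move=> Sx; have := drift_target Sx; move: Sx.
rewrite norm_triple_le; case E : (drift k beta g x) => [[u v] w].
case: x {E} => [[a b] c] /=.
move=> [/andP[? ?] /andP[? ?] /andP[? ?] _] [/andP[? ?] /andP[? ?] /andP[? ?] _].
have k0' := ltW k0.
by rewrite !ler_norml; apply/and3P; split; lra.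
Qed.

(** Over the single denominator [c + beta], which is at least [beta], the numerator of
the difference is a combination of the differences of the coordinates with
bounded coefficients. *)
Lemma lipschitz_qbeta : exists2 K, 0 <= K & forall x y, S x -> S y ->
  `|qbeta beta x - qbeta beta y| <= K * `|x - y|.
Proof.
exists ((2 + beta) / beta); first by rewrite divr_ge0 ?addr_ge0// ltW.
move=> x y Sx Sy; have := qbeta01 Sy; move: Sx Sy.
have := lexx `|x - y|; rewrite {1}norm_triple_le.
case: x y => [[a b] c] [[a' b'] c'] /=.
set m := `|_ - (a', b', c')|.
move=> /and3P[ma mb mc] [_ _ /andP[c0 _] _] [_ _ /andP[c'0 _] _].
set q := _ / (c' + beta) => /andP[q0 q1].
have m0 : 0 <= m by rewrite normr_ge0.
have cb : 0 < c + beta by rewrite ltr_wpDl.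
have cb' : 0 < c' + beta by rewrite ltr_wpDl.
have E : q * (c' + beta) = b' + beta * a' by rewrite /q divfK// gt_eqF.
have -> : (b + beta * a) / (c + beta) - q =
   ((b - b') + beta * (a - a') - q * (c - c')) / (c + beta).
  apply: (mulIf (lt0r_neq0 cb)); rewrite mulrBl !divfK ?gt_eqF//.
  lra.
rewrite normrM normfV (gtr0_norm cb) ler_pdivrMr//.
have N : `|b - b' + beta * (a - a') - q * (c - c')| <= (2 + beta) * m.
  have h1 : `|beta * (a - a')| <= beta * m.
    by rewrite normrM (gtr0_norm beta0) ler_wpM2l// ltW.
  have h2 : `|q * (c - c')| <= m.
    by rewrite normrM (ger0_norm q0) (le_trans _ mc)// ler_piMl.
  rewrite (le_trans (ler_normB _ _))// (le_trans (lerD (ler_normD _ _) h2))//.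
  lra.
apply: (le_trans N).
have -> : (2 + beta) / beta * m * (c + beta) =
  (2 + beta) * (m * ((c + beta) / beta)) by ring.
have b2 : 0 <= 2 + beta by rewrite addr_ge0// ltW.
rewrite ler_wpM2l// ler_peMr//.
by rewrite ler_pdivlMr// mul1r lerDr.
Qed.

Lemma lipschitz_drift : exists2 L, 0 <= L & forall x y, S x -> S y ->
  `|h x - h y| <= L * `|x - y|.
Proof.
have [Q Q0 HQ] := lipschitz_qbeta.
have [K1 K10 HK1] := lipschitz_binomial_mean k (fun y => g (y%:R / k%:R)).
have [K2 K20 HK2] := lipschitz_binomial_mean k (fun y => y%:R * g (y%:R / k%:R)).
have [K3 K30 HK3] := lipschitz_binomial_mean k
   (fun y => y%:R * g (y%:R / k%:R) + (k%:R - y%:R) * (1 - g (y%:R / k%:R))).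
exists ((K1 + K2 + K3) * Q + 1); first by rewrite addr_ge0// mulr_ge0// !addr_ge0.
move=> x y Sx Sy; have Hq := HQ x y Sx Sy.
have qx := qbeta01 Sx; have qy := qbeta01 Sy.
have h1 := HK1 _ _ qx qy; have h2 := HK2 _ _ qx qy; have h3 := HK3 _ _ qx qy.
have comp (a b c d K : R) : 0 <= K -> K <= K1 + K2 + K3 ->
    `|a - b| <= K * `|qbeta beta x - qbeta beta y| -> `|c - d| <= `|x - y| ->
    `|(a - c) - (b - d)| <= ((K1 + K2 + K3) * Q + 1) * `|x - y|.
  move=> K0 KK ab cd.
  have -> : a - c - (b - d) = (a - b) - (c - d) by ring.
  rewrite (le_trans (ler_normB _ _))// mulrDl mul1r lerD// (le_trans ab)//.
  by rewrite -mulrA ler_pM.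
have := lexx `|x - y|; rewrite {1}norm_triple_le => /and3P[n1 n2 n3].
rewrite norm_triple_le; apply/and3P; split.
- by apply: (comp (H1 k beta g x) (H1 k beta g y) _ _ K1) => //; lra.
- by apply: (comp (H2 k beta g x) (H2 k beta g y) _ _ K2) => //; lra.
- by apply: (comp (H3 k beta g x) (H3 k beta g y) _ _ K3) => //; lra.
Qed.

Lemma compact_state_space : compact S.
Proof.
pose A := `[0, 1]%classic : set R; pose B := `[0, k%:R]%classic : set R.
have cABB : compact (A `*` B `*` B).
  by apply: compact_setX; [apply: compact_setX|]; exact: segment_compact.
have -> : S = (A `*` B `*` B) `&` [set x | 0 <= x.2 - x.1.2].
  apply/seteqP; split => -[[a b] c] /=; rewrite ?in_itv /= subr_ge0.
    by move=> [].
  by move=> [[[] ]].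
apply: compact_closedI => //.
have -> : [set x : R * R * R | 0 <= x.2 - x.1.2] =
  (fun x : R * R * R => x.2 - x.1.2) @^-1` [set y | 0 <= y] by [].
apply: preimage_closed; last exact: closed_ge.
move=> x _; apply: continuousB; first exact: cvg_snd.
apply: (@continuous_comp _ _ _ fst snd); [exact: cvg_fst|exact: cvg_snd].
Qed.

Lemma closed_state_space : closed S.
Proof.
apply: compact_closed; [exact: norm_hausdorff|exact: compact_state_space].
Qed.

End DriftField.

(** * Independent sampling and the binomial law *)

Section SampleSum.
Context (R : realType) (n k : nat).

Lemma sum_by_card (G : nat -> R) :
  \sum_(A : {set 'I_k}) G #|A| = \sum_(y < k.+1) 'C(k, y)%:R * G y.
Proof.
have lt (A : {set 'I_k}) : (#|A| < k.+1)%N.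
  by rewrite ltnS -[X in (_ <= X)%N](card_ord k) max_card.
rewrite (partition_big (fun A : {set 'I_k} => Ordinal (lt A)) xpredT)//=.
apply: eq_bigr => y _.
rewrite (eq_bigr (fun=> G y)); last by move=> A /eqP <-.
rewrite big_const iter_addr_0 mulr_natl; congr (_ *+ _).
rewrite -(_ : 'C(#|'I_k|, y) = 'C(k, y)); last by rewrite card_ord.
rewrite -card_draws; apply: eq_card => A.
by rewrite [in RHS]inE.
Qed.

(** Group the samples [u] by the set of positions holding a vertex of type [x]: for
each set the sum of the products factorizes, and only its cardinal matters. *)
Lemma sum_samples (w : 'I_n -> R) (x : pred 'I_n) (F : nat -> R) :
  \sum_i w i = 1 ->
  \sum_(u : {ffun 'I_k -> 'I_n}) (\prod_j w (u j)) * F #|[pred j | x (u j)]| =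
  \sum_(y < k.+1) binomial_pmf k (\sum_(i | x i) w i) y * F y.
Proof.
move=> w1; set q := \sum_(i | x i) w i.
have q1 : \sum_(i | ~~ x i) w i = 1 - q.
  by rewrite -w1 [X in _ = X - q](bigID x) /= -/q addrAC subrr add0r.
pose plus (u : {ffun 'I_k -> 'I_n}) := finset (fun j => x (u j)).
rewrite (eq_bigr (fun u : {ffun _} => (\prod_j w (u j)) * F #|plus u|)); last first.
  by move=> u _; rewrite cardsE.
rewrite (partition_big plus xpredT)//=.
transitivity (\sum_(A : {set 'I_k}) (q ^+ #|A| * (1 - q) ^+ (k - #|A|)) * F #|A|).
  apply: eq_bigr => A _.
  under eq_bigr => u /eqP uA do rewrite uA.
  rewrite -mulr_suml; congr (_ * _).
  transitivity (\prod_(j < k) \sum_(i | x i == (j \in A)) w i).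
    rewrite (bigA_distr_big_dep (fun (j : 'I_k) (i : 'I_n) => x i == (j \in A)) (fun=> w)) /=.
    apply: eq_bigl => u; apply/eqP/familyP => [<- j|H].
      by rewrite !inE unfold_in eqxx.
    by apply/finset.setP => j; have := H j; rewrite unfold_in !inE => /eqP.
  rewrite (bigID (mem A)) /=; congr (_ * _).
    rewrite (eq_bigr (fun=> q)); first by rewrite prodr_const.
    by move=> j jA; apply: eq_bigl => i; rewrite jA eqb_id.
  rewrite (eq_bigr (fun=> 1 - q)).
    rewrite prodr_const; congr (_ ^+ _).
    have /(canRL (addKn _)) := cardC A; rewrite card_ord => <-.
    by apply: eq_card => j; rewrite !inE.
  by move=> j jA; rewrite -q1; apply: eq_bigl => i; rewrite (negbTE jA) eqbF_neg.
rewrite (sum_by_card (fun y => (q ^+ y * (1 - q) ^+ (k - y)) * F y)).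
by apply: eq_bigr => y _; rewrite mulrA mulr_natl.
Qed.

End SampleSum.

(** * A strong law for bounded orthogonal random variables *)

Section RealSequences.
Context (R : realType).

(** By comparison with the telescoping series of [2 / ((j + 1) (j + 2))]. *)
Lemma sum_inv_square_le n : \sum_(j < n) (j.+1%:R ^+ 2)^-1 <= (2 : R).
Proof.
suff : \sum_(j < n) (j.+1%:R ^+ 2)^-1 <= 2 - 2 / n.+1%:R :> R.
  by move=> /le_trans; apply; rewrite gerBl divr_ge0.
elim: n => [|n IH]; first by rewrite big_ord0 divr1 subrr.
rewrite big_ord_recr /= (le_trans (lerD IH (lexx _)))//.
have n1 : (0 : R) < n.+1%:R by rewrite ltr0n.
have -> : n.+2%:R = n.+1%:R + 1 :> R by rewrite natr1.
set x : R := n.+1%:R in n1 *.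
have x1 : 1 <= x by rewrite /x ler1n.
have x0 : 0 < x + 1 by rewrite ltr_wpDl// ltW.
rewrite -subr_ge0.
have -> : 2 - 2 / (x + 1) - (2 - 2 / x + (x ^+ 2)^-1) =
  (x - 1) / (x ^+ 2 * (x + 1)) by field; rewrite !gt_eqF.
by rewrite divr_ge0 ?subr_ge0// mulr_ge0 ?sqr_ge0// ltW.
Qed.

Lemma between_squares n : exists j, (j ^ 2 <= n <= j ^ 2 + 2 * j)%N.
Proof.
elim: n => [|n [j /andP[jn nj]]]; first by exists 0%N.
move: nj; rewrite leq_eqVlt => /predU1P[->|nj].
  by exists j.+1; rewrite !expnS !expn0; lia.
by exists j; rewrite nj (leq_trans jn).
Qed.

(** An integer [n] is at distance at most [2 j] from some [j ^ 2 <= n], and [2 j / n]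
is small. *)
Lemma averages_along_squares (a : nat -> R) (K : R) :
  (forall n, `|a n.+1 - a n| <= K) ->
  (fun j => a (j.+1 ^ 2)%N / (j.+1 ^ 2)%:R) @ \oo --> 0 ->
  (fun n => a n / n%:R) @ \oo --> 0.
Proof.
move=> aK /cvgrPdist_lt sq; apply/cvgrPdist_lt => e e0.
have K0 : 0 <= K := le_trans (normr_ge0 _) (aK 0%N).
have aD m n : `|a (m + n)%N - a m| <= K * n%:R.
  elim: n => [|n IH]; first by rewrite addn0 subrr normr0 mulr0.
  have -> : a (m + n.+1)%N - a m = (a (m + n).+1 - a (m + n)%N) + (a (m + n)%N - a m).
    by rewrite addnS subrKA.
  rewrite (le_trans (ler_normD _ _))// -natr1 mulrDr mulr1 addrC.
  by rewrite lerD.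
have e20 : 0 < e / 2 by rewrite divr_gt0.
have eK : 0 < e / (4 * (K + 1)) by rewrite divr_gt0// mulr_gt0// ltr_wpDl.
have [J _ HJ] := filterI (sq _ e20) (near_infty_natSinv_lt (PosNum eK)).
exists ((J.+2) ^ 2)%N => // n /= Jn.
have [j /andP[jn nj]] := between_squares n.
have Jj : (J < j)%N.
  have : (J.+2 ^ 2 < j.+1 ^ 2)%N.
    apply: leq_ltn_trans Jn _; apply: leq_ltn_trans nj _.
    by rewrite !expnS !expn0; lia.
  by rewrite ltn_exp2r// => ?; lia.
case: j Jj jn nj => // j Jj jn nj.
have [H1 /= H2] := HJ j Jj.
have n0 : (0 : R) < n%:R.
  by rewrite ltr0n (leq_trans _ jn)// expn_gt0.
have j0 : (0 : R) < (j.+1 ^ 2)%:R by rewrite ltr0n expn_gt0.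
have jnR : ((j.+1 ^ 2)%:R : R) <= n%:R by rewrite ler_nat.
rewrite sub0r normrN normrM normfV (gtr0_norm n0) ltr_pdivrMr//.
move: H1; rewrite /= sub0r normrN normrM normfV (gtr0_norm j0) ltr_pdivrMr// => H1.
have := aD (j.+1 ^ 2)%N (n - j.+1 ^ 2)%N; rewrite subnKC// => H3.
have H4 : ((n - j.+1 ^ 2)%:R : R) <= 2 * j.+1%:R.
  by rewrite -natrM ler_nat leq_subLR.
have H5 : (K + 1) * (2 * j.+1%:R) <= e / 2 * (j.+1 ^ 2)%:R.
  rewrite natrX expr2 mulrA mulrA ler_pM2r ?ltr0n//.
  have jp : (0 : R) < j.+1%:R by rewrite ltr0n.
  have H6 : j.+1%:R^-1 <= e / (4 * (K + 1)) by rewrite ltW.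
  have K1 : 0 < K + 1 by rewrite ltr_wpDl.
  have := ler_wpM2r (ltW jp) H6; rewrite mulVf ?gt_eqF//.
  have -> : e / (4 * (K + 1)) * j.+1%:R = e * j.+1%:R / (4 * (K + 1)) by ring.
  rewrite ler_pdivlMr ?mulr_gt0// mul1r; lra.
have -> : a n = (a n - a (j.+1 ^ 2)%N) + a (j.+1 ^ 2)%N by rewrite subrK.
rewrite (le_lt_trans (ler_normD _ _))// (le_lt_trans (lerD H3 (lexx _)))//.
have H7 : K * (n - j.+1 ^ 2)%:R <= (K + 1) * (2 * j.+1%:R).
  by rewrite ler_pM// lerDl.
have H8 := ler_wpM2l (ltW e0) jnR.
lra.
Qed.

End RealSequences.

Lemma probability_inhabited (R : realType) (d : measure_display)
  (T : measurableType d) (P : probability T R) : [set: T] !=set0.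
Proof.
apply/set0P/eqP => T0; have := @probability_setT _ _ _ P.
by rewrite T0 measure0 => /eqP; rewrite eq_sym onee_eq0.
Qed.

Section OrthogonalSLLN.
Context d (T : measurableType d) (R : realType) (P : probability T R).

Lemma integrable_bounded (f : T -> R) (K : R) : measurable_fun setT f ->
  (forall w, `|f w| <= K) -> P.-integrable setT (EFin \o f).
Proof.
move=> mf fK; apply: measurable_bounded_integrable => //.
  by rewrite (le_lt_trans (probability_le1 _ _))// ltry.
exists K; split; first exact: num_real.
by move=> r Kr w _; exact: le_trans (fK w) (ltW Kr).
Qed.

Variables (D : nat -> T -> R) (K : R).
Hypothesis mD : forall n, measurable_fun setT (D n).
Hypothesis DK : forall n w, `|D n w| <= K.
Hypothesis Dorth : forall m n, (m < n)%N ->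
  (\int[P]_w (D m w * D n w)%:E = 0)%E.

Let M (n : nat) (w : T) := \sum_(m < n) D m w.

Let mM n : measurable_fun setT (M n).
Proof. by apply: measurable_sum => i; exact: mD. Qed.

Let M_bound n w : `|M n w| <= K * n%:R.
Proof.
rewrite (le_trans (ler_norm_sum _ _ _))//.
apply: (@le_trans _ _ (\sum_(m < n) K)); first by apply: ler_sum => m _.
by rewrite sumr_const card_ord mulr_natr.
Qed.

Let K0 : 0 <= K.
Proof.
have [w _] := probability_inhabited P.
exact: le_trans (normr_ge0 _) (DK 0%N w).
Qed.

Let mulK (a b x y : R) : `|a| <= x -> `|b| <= y -> `|a * b| <= x * y.
Proof. by move=> ax bx; rewrite normrM ler_pM. Qed.

Let integralMD n : (\int[P]_w (M n w * D n w)%:E = 0)%E.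
Proof.
have iDD (m : 'I_n) : P.-integrable setT (EFin \o (fun w => D m w * D n w)).
  apply: (@integrable_bounded _ (K * K)) => [|w]; last exact: mulK.
  exact: measurable_funM.
rewrite (eq_integral (fun w => \sum_(m < n) (D m w * D n w)%:E)%E); last first.
  by move=> w _; rewrite /M mulr_suml sumEFin.
rewrite (@integral_sum _ _ _ P _ _ _ (fun m : 'I_n => EFin \o (fun w => D m w * D n w)))//.
by rewrite big1// => m _; exact: Dorth.
Qed.

Let integral_sqr n : (\int[P]_w (M n w ^+ 2)%:E <= (K ^+ 2 * n%:R)%:E)%E.
Proof.
elim: n => [|n IH].
  rewrite (eq_integral (fun=> 0%E)); last by move=> w _; rewrite /M big_ord0 expr0n.
  by rewrite integral0 mulr0.
have iMM : P.-integrable setT (EFin \o (fun w => M n w ^+ 2)).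
  apply: (@integrable_bounded _ (K * n%:R * (K * n%:R))) => [|w].
    exact: measurable_funX.
  by rewrite expr2; exact: mulK.
have iMD : P.-integrable setT (EFin \o (fun w => M n w * D n w)).
  apply: (@integrable_bounded _ (K * n%:R * K)) => [|w]; last exact: mulK.
  exact: measurable_funM.
have iDD : P.-integrable setT (EFin \o (fun w => D n w ^+ 2)).
  apply: (@integrable_bounded _ (K * K)) => [|w]; last by rewrite expr2; exact: mulK.
  exact: measurable_funX.
pose f1 w := M n w ^+ 2; pose f2 w := 2 * (M n w * D n w); pose f3 w := D n w ^+ 2.
have if2 : P.-integrable setT (EFin \o f2) := integrableZl measurableT 2 iMD.
have if12 : P.-integrable setT (EFin \o (fun w => f1 w + f2 w)) :=
  integrableD measurableT iMM if2.
rewrite (eq_integral (fun w => ((EFin \o (fun w => (f1 w + f2 w)%R)) \+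
    (EFin \o f3)) w)%E); last first.
  move=> w _; rewrite /= /f1 /f2 /f3 /M big_ord_recr /= -EFinD; congr EFin.
  ring.
rewrite integralD_EFin//.
rewrite (eq_integral (fun w => ((EFin \o f1) \+ (EFin \o f2)) w)%E)//.
rewrite integralD_EFin//.
rewrite [X in (_ + X + _)%E](_ : _ = 0%E); last first.
  rewrite (eq_integral (fun w => 2%:E * (EFin \o (fun w => (M n w * D n w)%R)) w)%E)//.
  by rewrite integralZl// integralMD mule0.
rewrite adde0 -natr1 mulrDr mulr1 EFinD.
apply: leeD => //.
rewrite -[leRHS]mule1 -(@probability_setT _ _ _ P) -integral_cst//.
apply: le_integral => //.
  by apply: (@integrable_bounded (fun=> K ^+ 2) (K ^+ 2)) => // w; rewrite ger0_norm// sqr_ge0.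
by move=> w _; rewrite /= /f3 lee_fin -[D n w ^+ 2]real_normK ?num_real// !expr2 ler_pM.
Qed.

Let f (j : nat) (w : T) : R := (M (j.+1 ^ 2) w / (j.+1 ^ 2)%:R) ^+ 2.

Let integral_f j : (\int[P]_w (f j w)%:E <= (K ^+ 2 / (j.+1%:R ^+ 2))%:E)%E.
Proof.
set c : R := (j.+1 ^ 2)%:R.
have c0 : 0 < c by rewrite /c ltr0n expn_gt0.
rewrite (eq_integral (fun w => (c^-1 ^+ 2)%:E * (M (j.+1 ^ 2) w ^+ 2)%:E)%E); last first.
  by move=> w _; rewrite /f -EFinM; congr EFin; rewrite -/c; ring.
have mM2 : measurable_fun setT (fun w => (M (j.+1 ^ 2) w ^+ 2)%:E).
  by apply/measurable_EFinP; exact: measurable_funX.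
rewrite ge0_integralZl//; last 2 first.
- by move=> w _; rewrite lee_fin sqr_ge0.
- by rewrite lee_fin sqr_ge0.
apply: (le_trans (lee_wpmul2l _ (integral_sqr (j.+1 ^ 2)))).
  by rewrite lee_fin sqr_ge0.
rewrite -EFinM lee_fin -/c -natrX -/c le_eqVlt; apply/orP; left; apply/eqP.
by field; rewrite gt_eqF.
Qed.

(** The squares of the averages along [j ^ 2] have integrals at most [K^2 / j^2];
their sum is integrable, hence almost surely finite, and its terms vanish. *)
Lemma orthogonal_slln :
  {ae P, forall w, (\sum_(m < n) D m w) / n%:R @[n --> \oo] --> (0 : R)}.
Proof.
pose g (w : T) : \bar R := (\sum_(0 <= j <oo) (f j w)%:E)%E.
have mf j : measurable_fun setT (fun w => (f j w)%:E).
  apply/measurable_EFinP; apply: measurable_funX; exact: measurable_funM.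
have f0 j w : (0 <= (f j w)%:E)%E by rewrite lee_fin sqr_ge0.
have mg : measurable_fun setT g.
  exact: ge0_emeasurable_sum.
have g0 w : (0 <= g w)%E by exact: nneseries_ge0.
have ig : P.-integrable setT g.
  apply/integrableP; split => //.
  rewrite (eq_integral g); last by move=> w _; rewrite gee0_abs.
  rewrite /g integral_nneseries//.
  apply: (@le_lt_trans _ _ (2 * K ^+ 2)%:E); last exact: ltry.
  apply: lime_le.
    by apply: is_cvg_nneseries => n _ _; exact: integral_ge0.
  near=> n.
  apply: (@le_trans _ _ (\sum_(0 <= j < n) (K ^+ 2 / (j.+1%:R ^+ 2))%:E)%E).
    by apply: lee_sum => j _; exact: integral_f.
  rewrite sumEFin lee_fin big_mkord -mulr_sumr mulrC ler_wpM2r ?sqr_ge0//.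
  exact: sum_inv_square_le.
apply: filterS (integrable_ae measurableT ig) => w /(_ I) gfin.
have cf : (fun j => f j w) @ \oo --> 0.
  apply: cvg_series_cvg_0; apply: nondecreasing_is_cvgn.
    by apply: nondecreasing_series => n _ _; rewrite sqr_ge0.
  exists (fine (g w)) => _ [n _ <-].
  rewrite -lee_fin fineK// /series /= -sumEFin.
  exact: nneseries_lim_ge.
apply: (@averages_along_squares R (fun n => M n w) K).
  by move=> n; rewrite /M big_ord_recr /= addrAC subrr add0r.
apply/cvgrPdist_lt => e e0; move/cvgrPdist_lt : cf => /(_ (e ^+ 2)).
rewrite exprn_gt0// => /(_ isT); apply: filterS => j /=.
rewrite !sub0r !normrN /f normrX => H.
by rewrite -(@ltr_pXn2r _ 2)// nnegrE ?normr_ge0// ltW.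
Unshelve. all: by end_near. Qed.

End OrthogonalSLLN.

(** * Evolution of the counts along a path *)

Section Paths.
Context (d : measure_display) (T : measurableType d).
Context (N k : nat) (X : nat -> T -> bool) (U : nat -> 'I_k -> T -> nat).
Hypothesis Urange : forall n j w, (N <= n)%N -> (U n j w < n)%N.

(** Sets of positions are counted in the model as classical sets; a sum of booleans
is what the computations need. *)
Lemma card_classical_set (P : pred 'I_k) :
  #|[set j : 'I_k | P j]| = (\sum_(j < k) P j)%N.
Proof.
rewrite -sum1_card [LHS]big_mkcond /=. apply: eq_bigr => j _.
have -> : (j \in [set j : 'I_k | P j]) = P j by apply/idP/idP; rewrite inE.
by case: (P j).
Qed.

Lemma plus_count_le n w : (plus_count X U n w <= k)%N.
Proof. by rewrite /plus_count -[leqRHS](card_ord k) max_card. Qed.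

Lemma indegS n i w : (N <= n)%N ->
  indeg N X U n.+1 i w = (indeg N X U n i w + edge_mult X U n i w)%N.
Proof. by move=> Nn; rewrite /indeg big_nat_recr. Qed.

Lemma edge_mult0 m i w : (N <= m)%N -> (m <= i)%N -> edge_mult X U m i w = 0%N.
Proof.
move=> Nm mi; rewrite /edge_mult card_classical_set big1// => j _.
by rewrite ltn_eqF// (leq_trans (Urange _ _ Nm)).
Qed.

Lemma indeg0 n i w : (n <= i.+1)%N -> indeg N X U n i w = 0%N.
Proof.
move=> ni; rewrite /indeg big_nat big1// => m /andP[Nm mn].
by apply: edge_mult0 => //; lia.
Qed.

(** An edge from [n] is seen from its target on the left and from its position in the
sample on the right. *)
Lemma sum_edge_mult n w (Q : pred bool) : (N <= n)%N ->
  (\sum_(i < n | Q (X i w)) edge_mult X U n i w)%N =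
  (\sum_(j < k) (Q (X (U n j w) w) && (X (U n j w) w == X n w)))%N.
Proof.
move=> Nn; under eq_bigr do rewrite /edge_mult card_classical_set.
rewrite exchange_big /=; apply: eq_bigr => j _.
have Un := Urange j w Nn.
rewrite big_mkcond (bigD1 (Ordinal Un)) //= eqxx big1 ?addn0.
  by case: (Q _).
move=> i; rewrite -val_eqE /= eq_sym => /negbTE ->.
by case: (Q _).
Qed.

Lemma countAS n w : countA X n.+1 w = (countA X n w + X n w)%N.
Proof.
by rewrite /countA big_mkcond big_ord_recr /= -big_mkcond; case: (X n w).
Qed.

Lemma countBS n w : (N <= n)%N -> countB N X U n.+1 w =
  (countB N X U n w + (if X n w then plus_count X U n w else 0))%N.
Proof.
move=> Nn; rewrite /countB big_mkcond big_ord_recr /= indeg0// if_same addn0.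
rewrite -big_mkcond /=.
under eq_bigr do rewrite indegS//.
rewrite big_split /=; congr (_ + _)%N.
rewrite (sum_edge_mult w id)//.
case: ifP => Xn; last first.
  by rewrite big1// => j _; case: (X (U n j w) w).
rewrite /plus_count card_classical_set; apply: eq_bigr => j _.
by case: (X (U n j w) w).
Qed.

Lemma countCS n w : (N <= n)%N -> countC N X U n.+1 w =
  (countC N X U n w +
   (if X n w then plus_count X U n w else k - plus_count X U n w))%N.
Proof.
move=> Nn; rewrite /countC big_ord_recr /= indeg0// addn0.
under eq_bigr do rewrite indegS//.
rewrite big_split /=; congr (_ + _)%N.
rewrite (sum_edge_mult w predT)//= /plus_count card_classical_set.
case: ifP => Xn.
  by apply: eq_bigr => j _; case: (X (U n j w) w).
apply/eqP; rewrite -(eqn_add2r (\sum_(j < k) X (U n j w) w)%N) subnK; last first.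
  by rewrite -card_classical_set -[leqRHS](card_ord k) max_card.
rewrite -big_split /= -[X in _ == X](card_ord k) -sum1_card; apply/eqP.
by apply: eq_bigr => j _; case: (X (U n j w) w).
Qed.

Lemma countB_start w : countB N X U N w = 0%N.
Proof. by rewrite /countB big1// => i _; rewrite /indeg big_geq. Qed.

Lemma countC_start w : countC N X U N w = 0%N.
Proof. by rewrite /countC big1// => i _; rewrite /indeg big_geq. Qed.

Lemma countA_le n w : (countA X n w <= n)%N.
Proof. by rewrite /countA sum1_card -[leqRHS](card_ord n) max_card. Qed.

Lemma countB_le n w : (countB N X U n w <= countC N X U n w)%N.
Proof. by rewrite /countB /countC [leqRHS](bigID (fun i : 'I_n => X i w)) /= leq_addr. Qed.

Lemma countC_le n w : (N <= n)%N -> (countC N X U n w <= k * n)%N.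
Proof.
move=> /subnKC <-; elim: (n - N)%N => [|m IH].
  by rewrite addn0 countC_start.
rewrite addnS countCS ?leq_addr// mulnS addnC leq_add//.
by case: ifP => _; [exact: plus_count_le|exact: leq_subr].
Qed.

Lemma statistics_state_space (R : realType) n w : (0 < n)%N -> (N <= n)%N ->
  state_space k (statistics R N X U w n).
Proof.
move=> n0 Nn; rewrite /statistics /=.
have n0R : (0 : R) < n%:R by rewrite ltr0n.
have C1 := countC_le w Nn; have B1 := countB_le n w.
have ok (m : nat) (r : nat) : (m <= r * n)%N -> 0 <= (m%:R / n%:R : R) <= r%:R.
  move=> mr; rewrite divr_ge0//= ler_pdivrMr// -natrM ler_nat//.
split.
- by apply: (ok _ 1%N); rewrite mul1n countA_le.
- by apply: ok; exact: leq_trans C1.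
- exact: ok.
- by rewrite ler_pM2r ?invr_gt0// ler_nat.
Qed.

End Paths.

(** * The past as a random variable with finitely many values *)

Section SigmaAlgebra.
Context (T : Type) (G : set (set T)).

Lemma sigma_set0 : <<s G >> set0.
Proof. exact: (@sigma_algebra0 _ setT G). Qed.

Lemma sigma_setC (E : set T) : <<s G >> E -> <<s G >> (~` E).
Proof. by move=> GE; rewrite -setTD; exact: sigma_algebraCD. Qed.

Lemma sigma_setT : <<s G >> setT.
Proof. by have := sigma_setC sigma_set0; rewrite setC0. Qed.

Lemma sigma_setI (E F : set T) : <<s G >> E -> <<s G >> F -> <<s G >> (E `&` F).
Proof.
move=> GE GF; rewrite -[_ `&` _]setCK setCI -bigcup2E.
apply: sigma_setC; apply: (@sigma_algebra_bigcup _ setT G) => i.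
case: i => [|[|n]] /=.
- exact: sigma_setC.
- exact: sigma_setC.
- exact: sigma_set0.
Qed.

Lemma sigma_fin_bigcap (I : finType) (E : I -> set T) :
  (forall i, <<s G >> (E i)) -> <<s G >> (\bigcap_(i in setT) E i).
Proof.
move=> HE.
have H (s : seq I) : <<s G >> [set w | forall i, i \in s -> E i w].
  elim: s => [|j s IH].
    rewrite [X in <<s G >> X](_ : _ = setT); first exact: sigma_setT.
    by apply/seteqP; split.
  rewrite [X in <<s G >> X](_ : _ = E j `&` [set w | forall i, i \in s -> E i w]).
    exact: sigma_setI.
  apply/seteqP; split => w /=.
    move=> H; split; first by apply: H; rewrite mem_head.
    by move=> i si; apply: H; rewrite inE si orbT.
  by move=> [Hj Hs] i; rewrite inE => /predU1P[->//|]; exact: Hs.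
have -> : \bigcap_(i in setT) E i = [set w | forall i, i \in enum I -> E i w].
  apply/seteqP; split => w /= Hw i; first by move=> _; exact: Hw.
  by move=> _; apply: Hw; rewrite mem_enum.
exact: H.
Qed.

End SigmaAlgebra.

Section PastCode.
Context (R : realType) (d : measure_display) (T : measurableType d).
Context (P : probability T R).
Context (N k : nat) (X : nat -> T -> bool) (U : nat -> 'I_k -> T -> nat).
Hypothesis Urange : forall n j w, (N <= n)%N -> (U n j w < n)%N.

(** [None] marks the epochs before [N], where the samples are unconstrained and may
fall outside ['I_n]. *)
Definition past_code_type (n : nat) : finType :=
  ({ffun 'I_n -> bool} * {ffun 'I_n * 'I_k -> option 'I_n})%type.

Definition past_code (n : nat) (w : T) : past_code_type n :=
  ([ffun i : 'I_n => X i w],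
   [ffun mj : 'I_n * 'I_k =>
      if (N <= mj.1)%N then insub (U mj.1 mj.2 w) else None]).

Definition same_past n w w' :=
  (forall i, (i < n)%N -> X i w = X i w') /\
  (forall m j, (N <= m < n)%N -> U m j w = U m j w').

Lemma past_codeP n w w' : past_code n w = past_code n w' -> same_past n w w'.
Proof.
case=> /ffunP HX /ffunP HU; split => [i ni|m j /andP[Nm mn]].
  by have := HX (Ordinal ni); rewrite !ffunE.
have := HU (Ordinal mn, j); rewrite !ffunE /= Nm.
have lt w0 : (U m j w0 < n)%N by rewrite (ltn_trans (Urange _ _ Nm)).
have E w0 : insub (U m j w0) = Some (Ordinal (lt w0)) by exact: insubT.
by rewrite !E => -[].
Qed.

Lemma same_pastW m n w w' : (m <= n)%N -> same_past n w w' -> same_past m w w'.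
Proof.
move=> mn [HX HU]; split => [i im|i j /andP[Ni im]].
  by apply: HX; exact: leq_trans mn.
by apply: HU; rewrite Ni (leq_trans im).
Qed.

Lemma same_past_indeg n w w' i : same_past n w w' -> (i < n)%N ->
  indeg N X U n i w = indeg N X U n i w'.
Proof.
move=> [HX HU] ni; rewrite /indeg big_nat [RHS]big_nat.
apply: eq_bigr => m mn; rewrite /edge_mult !card_classical_set.
have /andP[_ mn'] := mn.
by apply: eq_bigr => j _; rewrite (HU _ _ mn) !HX.
Qed.

Lemma same_past_statistics n w w' : same_past n w w' ->
  statistics R N X U w n = statistics R N X U w' n.
Proof.
move=> H; rewrite /statistics.
have HX (i : 'I_n) : X i w = X i w' by case: H => + _; apply.
have HI (i : 'I_n) : indeg N X U n i w = indeg N X U n i w'.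
  exact: same_past_indeg.
congr (_%:R / _, _%:R / _, _%:R / _).
- by apply: eq_bigl => i; rewrite HX.
- by rewrite /countB (eq_bigl _ _ (HX : _ =1 _)); apply: eq_bigr => i _.
- by apply: eq_bigr => i _.
Qed.

Lemma same_past_weight beta n w w' i : same_past n w w' -> (i < n)%N ->
  sampling_weight N X U beta n i w = sampling_weight N X U beta n i w' :> R.
Proof.
move=> H ni; rewrite /sampling_weight (same_past_indeg H ni).
by congr (_ / (_ + _)); apply: eq_bigr => l _; rewrite (same_past_indeg H).
Qed.

Lemma same_past_plus_count m n w w' : (N <= m < n)%N -> same_past n w w' ->
  plus_count X U m w = plus_count X U m w'.
Proof.
move=> /andP[Nm mn] [HX HU]; rewrite /plus_count !card_classical_set.
apply: eq_bigr => j _; rewrite HU ?Nm// HX//.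
exact: ltn_trans (Urange _ _ Nm) mn.
Qed.

Lemma history_fin_bigcap a b (I : finType) (E : I -> set T) :
  (forall i, history N X U a b (E i)) ->
  history N X U a b (\bigcap_(i in setT) E i).
Proof. by move=> HE; apply: sigma_fin_bigcap. Qed.

Lemma history_setI a b (E F : set T) : history N X U a b E ->
  history N X U a b F -> history N X U a b (E `&` F).
Proof. exact: sigma_setI. Qed.

Lemma history_state a b i (B : set bool) : (i < a)%N ->
  history N X U a b (X i @^-1` B).
Proof.
move=> ia; apply: sub_sigma_algebra; left; exists i => //.
by exists B => //; rewrite setTI.
Qed.

Lemma history_sample a b m j (B : set nat) : (N <= m < b)%N ->
  history N X U a b (U m j @^-1` B).
Proof.
move=> mb; apply: sub_sigma_algebra; right; exists m, j; split => //.
by exists B => //; rewrite setTI.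
Qed.

Lemma history_past_code n b (c : past_code_type n) : (n <= b)%N ->
  history N X U n b (past_code n @^-1` [set c]).
Proof.
move=> nb.
have -> : past_code n @^-1` [set c] =
  (\bigcap_(i in [set: 'I_n]) (X i @^-1` [set c.1 i])) `&`
  (\bigcap_(mj in [set: 'I_n * 'I_k])
     [set w | (if (N <= mj.1)%N then insub (U mj.1 mj.2 w) else None) = c.2 mj]).
  apply/seteqP; split => w /=.
    move=> <-; split => [i _|mj _] /=; by rewrite ffunE.
  case: c => c1 c2 /= [H1 H2]; congr (_, _); apply/ffunP => i; rewrite ffunE.
    exact: H1.
  exact: H2.
apply: history_setI; apply: history_fin_bigcap => i; first exact: history_state.
have [Ni|_] := leqP N i.1.
  apply: (@history_sample n b i.1 i.2 [set x | insub x = c.2 i]).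
  by rewrite Ni (leq_trans (ltn_ord _)).
have [E|E] := pselect (None = c.2 i).
  rewrite (_ : [set _ | _] = setT); last by apply/seteqP; split.
  exact: sigma_setT.
rewrite (_ : [set _ | _] = set0); last by apply/seteqP; split.
exact: sigma_set0.
Qed.

Definition sample (n : nat) (Nn : (N <= n)%N) (w : T) : {ffun 'I_k -> 'I_n} :=
  [ffun j => Ordinal (Urange j w Nn)].

Lemma history_sample_fiber n b (Nn : (N <= n)%N) (u : {ffun 'I_k -> 'I_n}) :
  (n < b)%N -> history N X U n b (sample Nn @^-1` [set u]).
Proof.
move=> nb; have -> : sample Nn @^-1` [set u] =
    \bigcap_(j in [set: 'I_k]) (U n j @^-1` [set (u j : nat)]).
  apply/seteqP; split => w /=.
    by move=> <- j _ /=; rewrite ffunE.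
  by move=> H; apply/ffunP => j; rewrite ffunE; apply/val_inj; exact: H.
by apply: history_fin_bigcap => j; apply: history_sample; rewrite Nn.
Qed.

Lemma sampleE n (Nn : (N <= n)%N) (u : {ffun 'I_k -> 'I_n}) :
  sample Nn @^-1` [set u] = [set w | forall j, U n j w = u j].
Proof.
apply/seteqP; split => w /=; first by move=> <- j; rewrite ffunE.
by move=> H; apply/ffunP => j; rewrite ffunE; exact/val_inj/H.
Qed.

Hypothesis mX : forall i, measurable_fun setT (X i).
Hypothesis mU : forall n j, (N <= n)%N -> measurable_fun setT (U n j).

Lemma history_measurable a b E : history N X U a b E -> measurable E.
Proof.
apply: smallest_sub; first exact: sigma_algebra_measurable.
move=> F [[i _ [B mB <-]]|[m [j [/andP[Nm _] [B mB <-]]]]].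
  exact: mX.
exact: mU.
Qed.

End PastCode.

(** * Conditional centring of the increments *)

Lemma sum_triple (R : nmodType) (A B C : finType) (f : A * B * C -> R) :
  \sum_i f i = \sum_a \sum_b \sum_c f (a, b, c).
Proof.
rewrite pair_big pair_big /=.
by apply: eq_bigr => -[[]].
Qed.

Section FiniteCode.
Context (R : realType) (d : measure_display) (T : measurableType d).
Context (P : probability T R) (I : finType) (c : T -> I) (v : I -> R).
Hypothesis mc : forall i, measurable (c @^-1` [set i]).

Lemma finite_code_indic w : v (c w) = \sum_i v i * \1_(c @^-1` [set i]) w.
Proof.
rewrite (bigD1 (c w)) //= big1 ?addr0; last first.
  move=> i ic; rewrite indicE memNset ?mulr0//= => /esym /eqP.
  by rewrite (negbTE ic).
by rewrite indicE mem_set// mulr1.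
Qed.

Lemma measurable_finite_code : measurable_fun setT (fun w => v (c w)).
Proof.
under eq_fun do rewrite finite_code_indic.
apply: measurable_sum => i; apply: measurable_funM => //.
Qed.

Lemma integral_finite_code :
  (\int[P]_w (v (c w))%:E = (\sum_i v i * fine (P (c @^-1` [set i])))%:E)%E.
Proof.
have iind i : P.-integrable setT (EFin \o \1_(c @^-1` [set i])).
  apply: (@integrable_bounded _ _ _ _ _ 1); first exact: measurable_indic.
  by move=> w; rewrite indicE; case: (_ \in _); rewrite ?normr1 ?normr0.
rewrite (eq_integral (fun w => \sum_i ((v i)%:E *
  (EFin \o \1_(c @^-1` [set i])) w))%E); last first.
  by move=> w _; rewrite finite_code_indic -sumEFin.
rewrite (@integral_sum _ _ _ P _ _ _
  (fun i w => ((v i)%:E * (EFin \o \1_(c @^-1` [set i])) w)%E))//; last first.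
  by move=> i; exact: integrableZl.
rewrite -sumEFin; apply: eq_bigr => i _.
rewrite integralZl// integral_indic// setIT EFinM fineK//.
exact: fin_num_measure.
Qed.

End FiniteCode.

Section Innovations.
Context (R : realType) (d : measure_display) (T : measurableType d).
Context (P : probability T R).
Context (N k : nat) (hN : (0 < N)%N) (hk : (0 < k)%N) (beta : R) (beta0 : 0 < beta).
Context (g : R -> R) (X : nat -> T -> bool) (U : nat -> 'I_k -> T -> nat).
Hypothesis hmodel : fixed_sample_model P N X U beta g.
Hypothesis g01 : forall x, 0 <= x <= 1 -> 0 <= g x <= 1.

Let Urange := samples_range hmodel.
Let mX := states_measurable hmodel.
Let mU := samples_measurable hmodel.

Local Notation stat w n := (statistics R N X U w n).
Local Notation weight n i w := (sampling_weight N X U beta n i w).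

Lemma total_weight_gt0 n w : (N <= n)%N ->
  0 < \sum_(l < n) (indeg N X U n l w)%:R + n%:R * beta.
Proof.
move=> Nn; rewrite ltr_wpDl ?sumr_ge0// mulr_gt0// ltr0n.
exact: leq_trans Nn.
Qed.

Lemma sum_weight n w : (N <= n)%N -> \sum_(i < n) weight n i w = 1.
Proof.
move=> Nn; rewrite -mulr_suml big_split /= sumr_const card_ord -[beta *+ n]mulr_natl.
by rewrite divff// gt_eqF// total_weight_gt0.
Qed.

(** This is the identity that closes the system: the law of the next sample depends
on the past only through the three statistics. *)
Lemma sum_weight_plus n w : (N <= n)%N ->
  \sum_(i < n | X i w) weight n i w = qbeta beta (stat w n).
Proof.
move=> Nn; have n0 : (0 : R) < n%:R by rewrite ltr0n (leq_trans hN).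
rewrite -mulr_suml big_split /= sumr_const /qbeta /statistics.
have t0 := total_weight_gt0 w Nn.
have -> : \sum_(i < n | X i w) (indeg N X U n i w)%:R = (countB N X U n w)%:R :> R.
  by rewrite -natr_sum.
have -> : beta *+ #|(fun i : 'I_n => X i w)| = (countA X n w)%:R * beta.
  by rewrite mulr_natl /countA sum1_card.
move: t0; rewrite -natr_sum -/(countC N X U n w).
set a : R := (countA _ _ _)%:R; set b : R := (countB _ _ _ _ _)%:R.
set c : R := (countC _ _ _ _ _)%:R => t0.
have -> : c / n%:R + beta = (c + n%:R * beta) / n%:R by field; rewrite gt_eqF.
by field; rewrite !gt_eqF.
Qed.

Section OneStep.
Variables (n : nat) (Nn : (N <= n)%N).
Let code := past_code N X U n.
Let sam := sample Urange Nn.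

Let mcode c : measurable (code @^-1` [set c]).
Proof.
apply: (history_measurable mX mU (a := n) (b := n)).
exact: history_past_code.
Qed.

Let plus_of (w0 : T) (u : {ffun 'I_k -> 'I_n}) := #|[pred j | X (u j) w0]|.

Let measurable_atom (w0 : T) (u : {ffun 'I_k -> 'I_n}) :
  measurable (code @^-1` [set code w0] `&` sam @^-1` [set u]).
Proof.
apply: measurableI => //.
apply: (history_measurable mX mU (a := n) (b := n.+1)).
exact: history_sample_fiber.
Qed.

Lemma sample_law w0 u :
  P (code @^-1` [set code w0] `&` sam @^-1` [set u]) =
  ((\prod_j weight n (u j) w0)%:E * P (code @^-1` [set code w0]))%E.
Proof.
have [_ law] := samples_law hmodel u Nn.
rewrite /sam sampleE law; last exact: history_past_code.
rewrite -integral_cst//; apply: eq_integral => w; rewrite inE /= => cw.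
congr EFin; apply: eq_bigr => j _.
by apply: same_past_weight => //; exact: past_codeP cw.
Qed.

Lemma state_true_law w0 u :
  P (code @^-1` [set code w0] `&` sam @^-1` [set u] `&` [set w | X n w]) =
  ((g ((plus_of w0 u)%:R / k%:R))%:E *
     P (code @^-1` [set code w0] `&` sam @^-1` [set u]))%E.
Proof.
have [_ law] := state_law hmodel Nn.
rewrite law; last first.
  apply: history_setI; first exact: history_past_code.
  exact: history_sample_fiber.
rewrite -integral_cst//; apply: eq_integral => w; rewrite inE /= => -[cw sw].
have [HX _] := past_codeP Urange cw.
congr (g (_%:R / _))%:E; rewrite /plus_count card_classical_set /plus_of -sum1_card.
rewrite [RHS]big_mkcond /=; apply: eq_bigr => j _.
have -> : U n j w = u j by rewrite -sw ffunE.
by rewrite HX// inE; case: (X _ _).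
Qed.

(** The conditional laws of the model, read on a single atom of the past, where the
conditional probabilities are constant. *)
Lemma transition_law w0 u x :
  P (code @^-1` [set code w0] `&` sam @^-1` [set u] `&` [set w | X n w = x]) =
  ((\prod_j weight n (u j) w0 *
    (let gamma := g ((plus_of w0 u)%:R / k%:R) in
     if x then gamma else 1 - gamma))%:E * P (code @^-1` [set code w0]))%E.
Proof.
have mB := measurable_atom w0 u.
have mXn : measurable [set w | X n w] by rewrite -[X in measurable X]setTI; exact: mX.
case: x => /=.
  have := state_true_law w0 u; rewrite sample_law muleA -EFinM mulrC; exact.
set B := code @^-1` [set code w0] `&` sam @^-1` [set u] in mB *.
have : (P B = P (B `\` [set w | X n w]) + P (B `&` [set w | X n w]))%E :=
  measureDI P mB mXn.
rewrite /B state_true_law.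
have -> : code @^-1` [set code w0] `&` sam @^-1` [set u] `\` [set w | X n w] =
   code @^-1` [set code w0] `&` sam @^-1` [set u] `&` [set w | X n w = false].
  apply/seteqP; split => w /= [Bw Xw]; split => //; last by rewrite Xw.
  exact/negbTE/negP.
rewrite sample_law.
have fA : P (code @^-1` [set code w0]) \is a fin_num by exact: fin_num_measure.
have fB : P (code @^-1` [set code w0] `&` sam @^-1` [set u] `&`
    [set w | X n w = false]) \is a fin_num.
  apply: fin_num_measure; apply: measurableI => //.
  have := mX n measurableT (_ : measurable [set false]).
  by rewrite setTI; apply.
rewrite -(fineK fA) -(fineK fB) -!EFinM -EFinD.
move=> E; have {}E := EFin_inj E; congr EFin; move: E; lra.
Qed.

Let measurable_triple (i : past_code_type k n * {ffun 'I_k -> 'I_n} * bool) :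
  measurable ((fun w => (code w, sam w, X n w)) @^-1` [set i]).
Proof.
have -> : (fun w => (code w, sam w, X n w)) @^-1` [set i] =
    code @^-1` [set i.1.1] `&` sam @^-1` [set i.1.2] `&` [set w | X n w = i.2].
  case: i => [[c u] x]; apply/seteqP; split => w /=; first by move=> [-> -> ->].
  by move=> [[-> ->] ->].
apply: measurableI; first apply: measurableI => //.
  apply: (history_measurable mX mU (a := n) (b := n.+1)).
  exact: history_sample_fiber.
have := mX n measurableT (_ : measurable [set i.2]).
by rewrite setTI; apply.
Qed.

Section Innovation.
Variables (F : T -> R) (G : R * R * R -> nat -> bool -> R).

Let step_average (x : R * R * R) (y : nat) :=
  g (y%:R / k%:R) * G x y true + (1 - g (y%:R / k%:R)) * G x y false.

Let atom_point (w0 : T) c := xget w0 [set w | code w = c].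

Let code_atom_point w0 w : code (atom_point w0 (code w)) = code w.
Proof. by rewrite /atom_point; case: xgetP => [w' -> //|/(_ w)]; case. Qed.

(** The function of the finite code of (past, sample, new state) through which the
integrand of [integral_mul_past] factors. *)
Let step_value w0 (i : past_code_type k n * {ffun 'I_k -> 'I_n} * bool) :=
  F (atom_point w0 i.1.1) *
  G (stat (atom_point w0 i.1.1) n) (plus_of (atom_point w0 i.1.1) i.1.2) i.2.

Hypothesis Fpast : forall w w', same_past N X U n w w' -> F w = F w'.

Let step_valueE w0 w : F w * G (stat w n) (plus_count X U n w) (X n w) =
  step_value w0 (code w, sam w, X n w).
Proof.
have H := past_codeP Urange (esym (code_atom_point w0 w)).
rewrite /step_value /= (Fpast H) (same_past_statistics R H).
congr (_ * G _ _ _); rewrite /plus_count card_classical_set /plus_of -sum1_card.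
rewrite [RHS]big_mkcond /=; apply: eq_bigr => j _.
have [HX _] := H; rewrite inE ffunE /=.
by rewrite HX ?(Urange _ _ Nn)//; case: (X _ _).
Qed.

Lemma measurable_step :
  measurable_fun setT (fun w => F w * G (stat w n) (plus_count X U n w) (X n w)).
Proof.
have [w0 _] := probability_inhabited P.
rewrite (_ : (fun w => _) = fun w => step_value w0 (code w, sam w, X n w)).
  exact: (measurable_finite_code _ measurable_triple).
by apply/funext => w; exact: step_valueE.
Qed.

(** On each atom of the past, [F] and the statistics are constant; the sum over the
samples and the new state is a binomial mean of [step_average], which vanishes. *)
Lemma integral_mul_past :
  (forall x, state_space k x -> binomial_mean k (qbeta beta x) (step_average x) = 0) ->
  (\int[P]_w (F w * G (stat w n) (plus_count X U n w) (X n w))%:E = 0)%E.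
Proof.
move=> Gmean; have [w0 _] := probability_inhabited P.
pose v := step_value w0.
rewrite (eq_integral (fun w => (v (code w, sam w, X n w))%:E)); last first.
  by move=> w _; rewrite (step_valueE w0).
rewrite (@integral_finite_code _ _ _ P _ (fun w => (code w, sam w, X n w)))//.
congr EFin; rewrite sum_triple.
rewrite big1// => c _.
have [[w cw]|nc] := pselect (exists w, code w = c); last first.
  rewrite big1// => u _; rewrite big1// => x _.
  rewrite (_ : _ @^-1` _ = set0) ?measure0 ?mulr0//.
  by apply/seteqP; split => // w /= [cw _ _]; apply: nc; exists w.
have rc : code (atom_point w0 c) = c by rewrite -cw code_atom_point.
set r := atom_point w0 c in rc.
set pc := fine (P (code @^-1` [set c])).
have fib u x : fine (P ((fun w => (code w, sam w, X n w)) @^-1` [set (c, u, x)])) =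
    (\prod_j weight n (u j) r * (let gamma := g ((plus_of r u)%:R / k%:R) in
     if x then gamma else 1 - gamma)) * pc.
  have -> : (fun w => (code w, sam w, X n w)) @^-1` [set (c, u, x)] =
    code @^-1` [set code r] `&` sam @^-1` [set u] `&` [set w | X n w = x].
    rewrite rc; apply/seteqP; split => w' /=; first by move=> [-> -> ->].
    by move=> [[-> ->] ->].
  by rewrite transition_law rc fineM ?fin_num_measure.
transitivity (F r * pc * \sum_(u : {ffun 'I_k -> 'I_n})
    (\prod_j weight n (u j) r) * step_average (stat r n) (plus_of r u)).
  rewrite mulr_sumr; apply: eq_bigr => u _.
  by rewrite big_bool /= !fib /v /step_value /= -/r /step_average; ring.
rewrite (@sum_samples R n k (fun i => weight n i r) (fun i => X i r)
  (step_average (stat r n))) ?sum_weight//.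
rewrite sum_weight_plus//.
have Sr : state_space k (stat r n).
  by apply: statistics_state_space => //; exact: leq_trans Nn.
by rewrite -binomial_meanE ?Gmean ?mulr0//; exact: (qbeta01 beta0 Sr).
Qed.

End Innovation.
End OneStep.
End Innovations.

(** * Averages of the innovations vanish *)

Section InnovationSLLN.
Context (R : realType) (d : measure_display) (T : measurableType d).
Context (P : probability T R).
Context (N k : nat) (hN : (0 < N)%N) (hk : (0 < k)%N) (beta : R) (beta0 : 0 < beta).
Context (g : R -> R) (X : nat -> T -> bool) (U : nat -> 'I_k -> T -> nat).
Hypothesis hmodel : fixed_sample_model P N X U beta g.
Hypothesis g01 : forall x, 0 <= x <= 1 -> 0 <= g x <= 1.

Let Urange := samples_range hmodel.

Variable phi : bool -> nat -> R.
Hypothesis phi_itv : forall b y, (y <= k)%N -> 0 <= phi b y <= k%:R.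

Definition response_average (y : nat) :=
  g (y%:R / k%:R) * phi true y + (1 - g (y%:R / k%:R)) * phi false y.

Definition mean_response (x : R * R * R) :=
  binomial_mean k (qbeta beta x) response_average.

(** The model constrains the samples from epoch [N] on, and only from there on are the
deviations centred; the first [N] terms are set to 0, which does not change the
limit of the averages. *)
Definition innovation (n : nat) (w : T) : R :=
  if (N <= n)%N
  then phi (X n w) (plus_count X U n w) - mean_response (statistics R N X U w n)
  else 0.

Let mean_response_itv x : state_space k x -> 0 <= mean_response x <= k%:R.
Proof.
move=> Sx; apply: binomial_mean_itv => [|y yk]; first exact: qbeta01 Sx.
have /andP[g0 g1] : 0 <= g (y%:R / k%:R) <= 1.
  apply: g01; rewrite divr_ge0//= ler_pdivrMr ?ltr0n// mul1r ler_nat//.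
have /andP[a0 a1] := phi_itv true yk; have /andP[b0 b1] := phi_itv false yk.
have g1' : 0 <= 1 - g (y%:R / k%:R) by rewrite subr_ge0.
rewrite /response_average addr_ge0 ?mulr_ge0//=.
have := ler_wpM2l g0 a1; have := ler_wpM2l g1' b1; lra.
Qed.

Let innovation_bound n w : `|innovation n w| <= k%:R.
Proof.
rewrite /innovation; case: ifP => Nn; last by rewrite normr0.
have /andP[a0 a1] := phi_itv (X n w) (plus_count_le X U n w).
have /andP[b0 b1] : 0 <= mean_response (statistics R N X U w n) <= k%:R.
  apply: mean_response_itv; apply: statistics_state_space => //.
  exact: leq_trans Nn.
by rewrite ler_norml; apply/andP; split; lra.
Qed.

Let measurable_innovation n : measurable_fun setT (innovation n).
Proof.
rewrite /innovation; have [Nn|_] := leqP N n; last exact: measurable_cst.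
pose G (x : R * R * R) y b := phi b y - mean_response x.
rewrite [X in measurable_fun _ X](_ : _ = fun w => 1 *
    G (statistics R N X U w n) (plus_count X U n w) (X n w)); last first.
  by apply/funext => w; rewrite [RHS]mul1r.
exact: (measurable_step (F := fun=> 1) hmodel Nn G (fun _ _ _ => erefl)).
Qed.

Let orthogonal_innovation m n : (m < n)%N ->
  (\int[P]_w (innovation m w * innovation n w)%:E = 0)%E.
Proof.
move=> mn; have [Nn|nN] := leqP N n; last first.
  apply: integral0_eq => w _; rewrite /innovation [(N <= n)%N]leqNgt nN/=.
  by rewrite mulr0.
pose G (x : R * R * R) y b := phi b y - mean_response x.
rewrite (eq_integral (fun w => (innovation m w *
   G (statistics R N X U w n) (plus_count X U n w) (X n w))%:E)); last first.
  by move=> w _; rewrite /innovation Nn.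
apply: (integral_mul_past hN beta0 hmodel Nn) => [w w' ww'|x Sx].
  rewrite /innovation; case: ifP => // Nm.
  have ww'm := same_pastW (ltnW mn) ww'.
  rewrite (same_past_statistics R ww'm) (same_past_plus_count Urange _ ww') ?Nm//.
  by have [-> ] := ww'.
have q01 := qbeta01 beta0 Sx.
rewrite binomial_meanE//.
transitivity (\sum_(y < k.+1) (binomial_pmf k (qbeta beta x) y * response_average y) -
   \sum_(y < k.+1) (binomial_pmf k (qbeta beta x) y * mean_response x)).
  rewrite -sumrB; apply: eq_bigr => y _; rewrite /G /response_average; ring.
rewrite -(binomial_meanE k response_average q01).
rewrite -(binomial_meanE k (fun=> mean_response x) q01) binomial_mean_cst//.
exact: subrr.
Qed.

Lemma innovation_slln :
  {ae P, forall w, (\sum_(m < n) innovation m w) / n%:R @[n --> \oo] --> (0 : R)}.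
Proof. exact: (orthogonal_slln measurable_innovation innovation_bound). Qed.

End InnovationSLLN.

Definition countA_increment (R : realType) (b : bool) (y : nat) : R := b%:R.
Definition countB_increment (R : realType) (b : bool) (y : nat) : R := if b then y%:R else 0.
Definition countC_increment (R : realType) (k : nat) (b : bool) (y : nat) : R :=
  if b then y%:R else k%:R - y%:R.

(** * The statistics as a perturbed Euler scheme *)

Section Recursion.
Context (R : realType) (d : measure_display) (T : measurableType d).
Context (N k : nat) (hN : (0 < N)%N) (beta : R) (g : R -> R).
Context (X : nat -> T -> bool) (U : nat -> 'I_k -> T -> nat).
Hypothesis Urange : forall n j w, (N <= n)%N -> (U n j w < n)%N.

Local Notation innov phi m w := (innovation N beta g X U phi m w).

Definition averaged_noise (w : T) (n : nat) : R * R * R :=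
  ((\sum_(m < n) innov (@countA_increment R) m w) / n%:R,
   (\sum_(m < n) innov (@countB_increment R) m w) / n%:R,
   (\sum_(m < n) innov (@countC_increment R k) m w) / n%:R).

(** The identity behind the shifted form of [scheme_from]: averages [a / n] and
[s / n] updated with [xi] and [xi - H] differ in the end by an Euler step towards
[H]. *)
Lemma averaged_increment (a s xi H : R) n : (0 < n)%N ->
  (a + xi) / n.+1%:R - (s + (xi - H)) / n.+1%:R =
  a / n%:R - s / n%:R + n.+1%:R^-1 * (H - a / n%:R + s / n%:R).
Proof.
move=> n0; have n0R : (0 : R) < n%:R by rewrite ltr0n.
rewrite -[n.+1]addn1 natrD.
by field; rewrite !gt_eqF// ltr_wpDl// ltW.
Qed.

Lemma statistics_recursion w n : (N <= n)%N ->
  statistics R N X U w n.+1 - averaged_noise w n.+1 =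
  statistics R N X U w n - averaged_noise w n +
  n.+1%:R^-1 *: (drift k beta g (statistics R N X U w n) + averaged_noise w n).
Proof.
move=> Nn; have n0 : (0 < n)%N by exact: leq_trans Nn.
have pair3 (u v : R * R * R) : u.1.1 = v.1.1 -> u.1.2 = v.1.2 -> u.2 = v.2 -> u = v.
  by case: u v => [[? ?] ?] [[? ?] ?] /= -> -> ->.
set z := statistics R N X U w n.
have pk : (plus_count X U n w <= k)%N := plus_count_le X U n w.
apply: pair3 => /=; rewrite !big_ord_recr /= /innovation Nn -/z.
- rewrite countAS natrD.
  have -> : mean_response k beta g (@countA_increment R) z = H1 k beta g z.
    congr binomial_mean; apply/funext => y.
    by rewrite /response_average /countA_increment mulr1 mulr0 addr0.
  exact: averaged_increment.
- rewrite countBS// natrD.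
  have -> : mean_response k beta g (@countB_increment R) z = H2 k beta g z.
    congr binomial_mean; apply/funext => y.
    by rewrite /response_average /countB_increment mulr0 addr0 mulrC.
  have -> : (if X n w then plus_count X U n w else 0)%N%:R =
     countB_increment R (X n w) (plus_count X U n w).
    by rewrite /countB_increment; case: (X n w).
  exact: averaged_increment.
- rewrite countCS// natrD.
  have -> : mean_response k beta g (@countC_increment R k) z = H3 k beta g z.
    congr binomial_mean; apply/funext => y.
    by rewrite /response_average /countC_increment mulrC [X in _ + X]mulrC.
  have -> : (if X n w then plus_count X U n w else k - plus_count X U n w)%N%:R =
     countC_increment R k (X n w) (plus_count X U n w).
    by rewrite /countC_increment; case: (X n w) => //; rewrite natrB.
  exact: averaged_increment.
Qed.

End Recursion.

Lemma response01 (R : realType) (p : R) (f : R -> R) : 0 <= p <= 1 ->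
  (forall x, 0 <= x <= 1 -> 0 <= f x <= 1) ->
  forall x, 0 <= x <= 1 -> 0 <= response p f x <= 1.
Proof.
move=> /andP[p0 p1] hf x /hf /andP[f0 f1]; rewrite /response.
have q0 : 0 <= 1 - p by rewrite subr_ge0.
have f0' : 0 <= 1 - f x by rewrite subr_ge0.
have := ler_wpM2l p0 f1.
have := mulr_ge0 p0 f0; have := mulr_ge0 q0 f0'; have := mulr_ge0 q0 f0 => ? ? ? ?.
by apply/andP; split; lra.
Qed.

Theorem theorem4p1 (R : realType) (d : measure_display) (T : measurableType d)
    (P : probability T R) (N k : nat) (hN : (0 < N)%N) (hk : (0 < k)%N)
    (beta p : R) (hbeta : 0 < beta) (hp : 0 <= p <= 1) (hp2 : p != 2^-1)
    (f : R -> R) (hf : forall x : R, 0 <= x <= 1 -> 0 <= f x <= 1)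
    (X : nat -> T -> bool) (U : nat -> 'I_k -> T -> nat)
    (hmodel : fixed_sample_model P N X U beta (response p f)) :
  let S := state_space k : set (R * R * R) in
  let h := drift k beta (response p f) in
  {ae P, forall w,
    (exists x : R -> R * R * R,
       the_solution S h [set t | 0 <= t] ((countA X N w)%:R / N%:R, 0, 0) x) /\
    (exists L : set (R * R * R),
       [/\ L `<=` S, connected L, compact L,
           ode_invariant S h L & internally_chain_transitive S h L] /\
       converges_to_set (statistics R N X U w) L)}.
Proof.
move=> S h.
have g01 := response01 hp hf.
have Urange := samples_range hmodel.
have [L L0 hlip] := lipschitz_drift k hbeta (response p f).
have hbd := drift_bounded hk hbeta g01.
have cS : compact S := @compact_state_space R k.
have clS : closed S := @closed_state_space R k.
have huniq := ode_solution_unique hlip.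
have k1 : (1 : R) <= k%:R by rewrite ler1n.
have slln phi (hphi : forall b y, (y <= k)%N -> 0 <= phi b y <= k%:R) :=
  innovation_slln hN hk hbeta hmodel g01 hphi.
apply: filterS3 (slln (@countA_increment R) _) (slln (@countB_increment R) _)
  (slln (@countC_increment R k) _) => [w c1 c2 c3|b y yk|b y yk|b y yk]; last 3 first.
- by rewrite /countA_increment ler0n ler_nat; case: b.
- by rewrite /countB_increment; case: b; rewrite ?ler0n ?ler_nat ?lexx.
- rewrite /countC_increment; case: b; first by rewrite ler0n ler_nat.
  by rewrite subr_ge0 ler_nat yk gerBl ler0n.
split.
  have S0 : S ((countA X N w)%:R / N%:R, 0, 0).
    have := statistics_state_space X Urange R w hN (leqnn N).
    by rewrite /statistics countB_start countC_start !mul0r.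
  have [x xsol] := euler_forward_solution cS L0 hlip hbd
    (fun v d Sv d01 => drift_step hk hbeta g01 Sv d01) S0.
  exists x; split => // y ysol t; exact: (ode_solution_unique_forward hlip xsol ysol).
set z := statistics R N X U w.
pose eta := averaged_noise N beta (response p f) X U w.
have zD n : (N <= n)%N -> S (z n).
  by move=> Nn; apply: statistics_state_space => //; exact: leq_trans Nn.
have eta0 : eta @ \oo --> (0 : R * R * R).
  exact: (cvg_pair (cvg_pair c1 c2) c3).
have zS n : (N <= n)%N ->
  z n.+1 - eta n.+1 = z n - eta n + n.+1%:R^-1 *: (h (z n) + eta n).
  exact: statistics_recursion.
exists (limit_set z); split; last exact: (converges_to_limit_set cS zD).
have ict := chain_transitive_limit_set cS clS L0 hlip hbd huniq zD eta0 zS.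
split => //.
- exact: (limit_set_sub zD clS).
- exact: (connected_limit_set cS clS hbd zD eta0 zS).
- exact: (compact_limit_set cS clS zD).
- by case: ict.
Qed.
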